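(* Let $\Omega$ be bounded and strictly convex. Let $u$ be the convex envelope of $f$ in $\Omega$ (equivalently, the viscosity solution of $\min\{f-u,\lambda_1[D^2u]\}=0$ in $\Omega$, $u=f$ on $\partial\Omega$), and let $u_\varepsilon\in\mathbb V_h$ be the discrete solution of $$T_\varepsilon[u_\varepsilon;f](x_i)=0\quad\forall x_i\in\mathcal N_h^0,\qquad u_\varepsilon(x_i)=f(x_i)\quad\forall x_i\in\mathcal N_h^b .$$ If $u\in C^{k,\alpha}(\overline\Omega)$ for $k\in\{0,1\}$ and $0<\alpha\le1$, and $\theta\le1$, then there exists a constant $C=C(\Omega,d,\sigma)$ such that $$\|\mathcal I_hu-u_\varepsilon\|_{L^\infty(\Omega_h)}\le C\left[|u|_{C^{k,\alpha}(\overline\Omega)}\,\frac{(\delta\theta)^{k+\alpha}+h^{k+\alpha}+\delta^{2+k+\alpha}}{\delta^2}+|f|_{C^{k,\alpha}(\overline\Omega)}\,\delta^{k+\alpha}\right].$$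
   Context: $\Omega\subset\mathbb R^d$ is open and $f\in C(\overline\Omega)$. The convex envelope is $u(x)=\sup\{l(x): l\le f\text{ in }\overline\Omega,\ l\text{ affine}\}$; $\lambda_1[D^2u]$ is the smallest eigenvalue of the Hessian. $|\cdot|_{C^{k,\alpha}}$ denotes the Hölder seminorm with exponent $\alpha$ of the derivatives of order $k$ (interpreted as $+\infty$ if the function is not in $C^{k,\alpha}$). $\mathcal T_h$ is a conforming mesh of closed simplices $T$ with mesh size $h$, shape-regular and quasi-uniform with constant $\sigma$: $h_T/\rho_T\le\sigma$ and $h\le\sigma h_T\le \sigma h$ for all $T\in\mathcal T_h$, where $h_T$ is the diameter of $T$ and $\rho_T$ the diameter of the largest ball inscribed in $T$. $\Omega_h$ is the interior of the union of the elements; $\mathcal N_h$ is the set of nodes (vertices), $\mathcal N_h^b:=\{x_i\in\mathcal N_h: x_i\in\partial\Omega\}$ and $\mathcal N_h^0:=\mathcal N_h\setminus\mathcal N_h^b$. The nodes lying on $\partial\Omega_h$ are required to lie on $\partial\Omega$, and $\Omega_h\subset\Omega$ is convex. $\mathbb V_h$ is the space of continuous piecewise linear functions over $\mathcal T_h$ and $\mathcal I_h$ is the Lagrange interpolation operator onto $\mathbb V_h$. $\mathbb S$ is the unit sphere of $\mathbb R^d$, and $\mathbb S_\theta\subset\mathbb S$ is a finite set such that for every $v\in\mathbb S$ there is $v^\theta\in\mathbb S_\theta$ with $|v-v^\theta|\le\theta$. The coarse scale is $\delta\ge h$, and for $x_i\in\mathcal N_h^0$, $\delta_i:=\min\{\delta,\mathrm{dist}(x_i,\partial\Omega_h)\}$.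 For $w\in C(\overline{\Omega}_h)$, $x_i\in\mathcal N_h^0$, $v\in\mathbb S$, $$\nabla^2_\delta w(x_i;v):=\frac{w(x_i+\delta_i v)-2w(x_i)+w(x_i-\delta_i v)}{\delta_i^2}.$$ For $w_h\in\mathbb V_h$ and $x_i\in\mathcal N_h^0$, $$T_\varepsilon[w_h;f](x_i):=\min\Big\{f(x_i)-w_h(x_i),\ \min_{v\in\mathbb S_\theta}\nabla^2_\delta w_h(x_i;v)\Big\},\qquad \varepsilon=(h,\delta,\theta).$$ The discrete problem has a unique solution. The constant $C$ is independent of $h,\delta,\theta,u,f$. *)

(* Defs.v *)
From HB Require Import structures.
From mathcomp Require Import all_boot all_order all_algebra.
From mathcomp Require Import all_classical all_reals all_analysis.

Set Implicit Arguments.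
Unset Strict Implicit.
Unset Printing Implicit Defensive.
Import Order.TTheory GRing.Theory Num.Theory.
Import numFieldNormedType.Exports.

Local Open Scope classical_set_scope.
Local Open Scope ring_scope.

(* The library norm of 'rV[R]_d is the sup norm; it induces the usual topology
   and the usual bounded sets, but lengths have to be measured with enorm. *)
Definition enorm (R : realType) (d : nat) (x : 'rV[R]_d) : R :=
  Num.sqrt (\sum_(i < d) x 0 i ^+ 2).

Definition sphere (R : realType) (d : nat) : set 'rV[R]_d :=
  [set v | enorm v = 1].

Definition boundary (R : realType) (d : nat) (A : set 'rV[R]_d)
    : set 'rV[R]_d :=
  closure A `\` interior A.

Definition set_distance (R : realType) (d : nat) (x : 'rV[R]_d) (A : set 'rV[R]_d)
    : R :=
  inf [set enorm (x - y) | y in A].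

Definition diameter (R : realType) (d : nat) (A : set 'rV[R]_d) : R :=
  sup [set r | exists x y, [/\ A x, A y & r = enorm (x - y)]].

(* Diameter of the largest Euclidean ball contained in A. *)
Definition inscribed_diameter (R : realType) (d : nat) (A : set 'rV[R]_d) : R :=
  sup [set r | exists (c : 'rV[R]_d) (s : R),
        [/\ 0 <= s, [set x | enorm (x - c) <= s] `<=` A & r = 2 * s]].

(* For an open set A: its boundary contains no segment and A is convex. *)
Definition strictly_convex (R : realType) (d : nat) (A : set 'rV[R]_d) : Prop :=
  forall (x y : 'rV[R]_d) (t : R), closure A x -> closure A y -> x != y ->
    0 < t < 1 -> A (t *: x + (1 - t) *: y).

Definition affine_function (R : realType) (d : nat) (l : 'rV[R]_d -> R)
    : Prop :=
  exists (a : 'rV[R]_d) (b : R),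
    forall x, l x = \sum_(i < d) a 0 i * x 0 i + b.

Definition convex_envelope (R : realType) (d : nat) (Omega : set 'rV[R]_d)
    (f : 'rV[R]_d -> R) (x : 'rV[R]_d) : R :=
  sup [set l x | l in [set l : 'rV[R]_d -> R |
        affine_function l /\ forall y, closure Omega y -> l y <= f y]].

(* partial s g = D_(s_1) (D_(s_2) (... g)); s lists the coordinates. *)
Fixpoint partial (R : realType) (d : nat) (s : seq 'I_d) (g : 'rV[R]_d -> R)
    {struct s} : 'rV[R]_d -> R :=
  if s is i :: s' then fun x => 'D_(delta_mx 0 i) (partial s' g) x else g.

(* C^k(closure Omega): the partial derivatives of order at most k exist in
   Omega and extend continuously to closure Omega. *)
Definition Ck_closure (R : realType) (d : nat) (k : nat)
    (Omega : set 'rV[R]_d) (g : 'rV[R]_d -> R) : Prop :=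
  {within closure Omega, continuous g} /\
  forall s : seq 'I_d, (size s <= k)%N ->
    ((size s < k)%N -> forall (i : 'I_d) (x : 'rV[R]_d), Omega x ->
       derivable (partial s g) x (delta_mx 0 i)) /\
    exists2 G : 'rV[R]_d -> R, {within closure Omega, continuous G} &
      forall x, Omega x -> G x = partial s g x.

(* Quotients are taken in the open set: by continuity this gives the same
   supremum as over closure Omega. *)
Definition holder_quotients (R : realType) (d : nat) (k : nat) (alpha : R)
    (Omega : set 'rV[R]_d) (g : 'rV[R]_d -> R) : set R :=
  [set q | exists (s : seq 'I_d) (x y : 'rV[R]_d),
     [/\ size s = k, Omega x, Omega y, x != y &
         q = `|partial s g x - partial s g y| / enorm (x - y) `^ alpha]].

Definition holder_space (R : realType) (d : nat) (k : nat) (alpha : R)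
    (Omega : set 'rV[R]_d) (g : 'rV[R]_d -> R) : Prop :=
  Ck_closure k Omega g /\ has_ubound (holder_quotients k alpha Omega g).

Definition holder_seminorm (R : realType) (d : nat) (k : nat) (alpha : R)
    (Omega : set 'rV[R]_d) (g : 'rV[R]_d -> R) : \bar R :=
  if `[< holder_space k alpha Omega g >]
  then (sup (holder_quotients k alpha Omega g))%:E else +oo%E.

(* L^oo norm over A, for functions that are continuous on an open set A. *)
Definition sup_norm (R : realType) (d : nat) (A : set 'rV[R]_d)
    (w : 'rV[R]_d -> R) : \bar R :=
  ereal_sup [set (`|w x|)%:E | x in A].

Definition hull (R : realType) (d N : nat) (x : 'I_N -> 'rV[R]_d)
    (T : {set 'I_N}) : set 'rV[R]_d :=
  [set y | exists c : 'I_N -> R,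
     [/\ forall i, i \in T -> 0 <= c i, \sum_(i in T) c i = 1 &
         y = \sum_(i in T) c i *: x i]].

Definition affinely_independent (R : realType) (d N : nat)
    (x : 'I_N -> 'rV[R]_d) (T : {set 'I_N}) : Prop :=
  forall c : 'I_N -> R,
    \sum_(i in T) c i = 0 -> \sum_(i in T) c i *: x i = 0 ->
    forall i, i \in T -> c i = 0.

(* A conforming simplicial mesh. An element is given by the set of indices of
   its d + 1 vertices; two elements meet in the common face spanned by their
   common vertices (which may be empty). *)
Record mesh (R : realType) (d : nat) := Mesh {
  nb_nodes : nat;
  node : 'I_nb_nodes -> 'rV[R]_d;
  elements : {set {set 'I_nb_nodes}};
  node_inj : injective node;
  node_in_element : forall i, exists2 T, T \in elements & i \in T;
  card_element : forall T, T \in elements -> #|T| = d.+1;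
  element_nondegenerate :
    forall T, T \in elements -> affinely_independent node T;
  mesh_conforming : forall T T', T \in elements -> T' \in elements ->
    hull node T `&` hull node T' = hull node (T :&: T')
}.

Arguments node {R d} _ _.

Definition simplex (R : realType) (d : nat) (M : mesh R d)
    (T : {set 'I_(nb_nodes M)}) : set 'rV[R]_d :=
  hull (node M) T.

Definition mesh_domain (R : realType) (d : nat) (M : mesh R d)
    : set 'rV[R]_d :=
  interior [set x | exists2 T, T \in elements M & simplex T x].

Definition mesh_size (R : realType) (d : nat) (M : mesh R d) : R :=
  \big[Num.max/0]_(T in elements M) diameter (simplex T).

Definition shape_regular (R : realType) (d : nat) (sigma : R) (M : mesh R d)
    : Prop :=
  forall T, T \in elements M ->
    diameter (simplex T) / inscribed_diameter (simplex T) <= sigma.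

Definition quasi_uniform (R : realType) (d : nat) (sigma : R) (M : mesh R d)
    : Prop :=
  forall T, T \in elements M ->
    mesh_size M <= sigma * diameter (simplex T) <= sigma * mesh_size M.

Definition boundary_node (R : realType) (d : nat) (Omega : set 'rV[R]_d)
    (M : mesh R d) (i : 'I_(nb_nodes M)) : Prop :=
  boundary Omega (node M i).
Arguments boundary_node {R d} Omega M i.

Definition mesh_fits (R : realType) (d : nat) (Omega : set 'rV[R]_d)
    (M : mesh R d) : Prop :=
  [/\ mesh_domain M `<=` Omega,
      convex_set (mesh_domain M : set (convex_lmodType 'rV[R]_d)) &
      forall i, boundary (mesh_domain M) (node M i) -> boundary_node Omega M i].

Definition fe_space (R : realType) (d : nat) (M : mesh R d)
    : set ('rV[R]_d -> R) :=
  [set w | {within closure (mesh_domain M), continuous w} /\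
     forall T, T \in elements M ->
       exists2 l, affine_function l & forall x, simplex T x -> w x = l x].

(* The interpolant is determined on closure (mesh_domain M) only; its values
   elsewhere are irrelevant. *)
Definition lagrange_interp (R : realType) (d : nat) (M : mesh R d)
    (g : 'rV[R]_d -> R) : 'rV[R]_d -> R :=
  xget (fun=> 0)
    [set w | fe_space M w /\ forall i, w (node M i) = g (node M i)].

(* The finite set S_theta is given by a list of its elements. *)
Definition direction_net (R : realType) (d : nat) (theta : R)
    (S : seq 'rV[R]_d) : Prop :=
  (forall v, v \in S -> sphere v) /\
  (forall v, sphere v -> exists2 w, w \in S & enorm (v - w) <= theta).

Definition local_scale (R : realType) (d : nat) (M : mesh R d) (delta : R)
    (i : 'I_(nb_nodes M)) : R :=
  Num.min delta (set_distance (node M i) (boundary (mesh_domain M))).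
Arguments local_scale {R d} M delta i.

Definition second_difference (R : realType) (d : nat) (M : mesh R d)
    (delta : R) (w : 'rV[R]_d -> R) (i : 'I_(nb_nodes M)) (v : 'rV[R]_d) : R :=
  let delta_i := local_scale M delta i in
  (w (node M i + delta_i *: v) - 2 * w (node M i) + w (node M i - delta_i *: v))
    / delta_i ^+ 2.
Arguments second_difference {R d} M delta w i v.

(* min {f - w, min_(v in S) second_difference}: f - w is the initial value of
   the iterated minimum. *)
Definition two_scale (R : realType) (d : nat) (M : mesh R d) (delta : R)
    (S : seq 'rV[R]_d) (f w : 'rV[R]_d -> R) (i : 'I_(nb_nodes M)) : R :=
  \big[Num.min/(f (node M i) - w (node M i))]_(v <- S)
    second_difference M delta w i v.
Arguments two_scale {R d} M delta S f w i.

Definition discrete_solution (R : realType) (d : nat) (Omega : set 'rV[R]_d)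
    (M : mesh R d) (delta : R) (S : seq 'rV[R]_d) (f w : 'rV[R]_d -> R)
    : Prop :=
  [/\ fe_space M w,
      forall i : 'I_(nb_nodes M), ~ boundary_node Omega M i ->
        two_scale M delta S f w i = 0 &
      forall i : 'I_(nb_nodes M), boundary_node Omega M i ->
        w (node M i) = f (node M i)].

(* Main.v *)
Require Import Defs.
From mathcomp Require Import all_boot all_order all_algebra.
From mathcomp Require Import all_classical all_reals all_analysis.
From mathcomp Require Import ring lra.
Set Implicit Arguments.
Unset Strict Implicit.
Unset Printing Implicit Defensive.
Import Order.TTheory GRing.Theory Num.Theory.
Import numFieldNormedType.Exports.
Local Open Scope classical_set_scope.
Local Open Scope ring_scope.

(** Let e = ueps - u at the nodes, where u is the convex envelope, let s = k + alpha,
    and let H and Hf be constant multiples of the seminorms of u and f. Since ueps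
    and the interpolant of u are affine on every element, it suffices to bound e at
    the nodes.

    The interpolant of a convex function lies above the function, so the nodal
    values of u are a discrete subsolution; on the boundary u = f by strict
    convexity. Comparison gives 0 <= e (envelope_le_ueps).

    For the upper bound take a node x where e + A |x|^2 is largest, with A slightly
    above H ((delta theta)^s + h^s) / delta^2.

    Suppose first that x is farther than (d + 1) delta from the boundary. The point
    (x, u(x)) is a convex combination of d + 2 points of the graph of f
    (envelope_representation), and one of its weights is at least 1 / (d + 2). If
    the corresponding point is at distance at least (d + 1) delta from x, the
    segment from x - delta v to x + delta v in its direction v stays in the convex
    hull, and u does not bend along it (envelope_dichotomy). The slopes of u at the
    two ends then agree, so replacing v by a vector of S costs 2 H (delta theta)^s
    (turned_second_difference), and interpolation costs 2 H h^s
    (interpolation_error). Together these are less than 2 A delta^2, which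
    contradicts the maximality. Hence there is a contact point y of f and u with
    |x - y| < (d + 1) delta. There f - u has its minimum 0, its first-order part
    vanishes, and e(x) <= f(x) - u(x) <= (Hf + H) |x - y|^s (contact_gap).

    Suppose next that x is close to the boundary. Contact points may now lie on the
    boundary, where the slopes of f and u differ, so they are not used. Instead
    ueps is compared with the barrier given by the affine expansion of u at x plus
    H delta^s + H delta^(s-2) |y - x|^2 plus a multiple of a concave profile in the
    distance to a supporting hyperplane (boundary_layer_bound). As theta <= 1, some
    vector of S is transversal to the hyperplane, and in its direction the profile
    compensates the quadratic term. The interpolation error of the quadratic term
    is harmless because shape regularity gives h <= C delta_i (local_scale_bounds).
    The conclusion e(x) <= C H delta^s + m / 2, with m the maximum of e, allows m to
    be absorbed. The constants do not depend on alpha, since the majorant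
    |y - x|^s <= delta^s + delta^(s-2) |y - x|^2 is the same for all exponents in
    ]0, 2].

    For k = 0 and k = 1 the regularity enters only through expansions with constant
    or affine main part, valid up to the boundary (holder_taylor). *)

(** * Euclidean geometry of row vectors *)

Definition dot (R : realType) (d : nat) (x y : 'rV[R]_d) : R :=
  \sum_(i < d) x 0 i * y 0 i.

Section Euclidean.
Context {R : realType} {d : nat}.
Implicit Types (p x y z : 'rV[R]_d) (a : R).

Lemma dotC x y : dot x y = dot y x.
Proof. by apply: eq_bigr => i _; rewrite mulrC. Qed.

Lemma dotDl x y z : dot (x + y) z = dot x z + dot y z.
Proof. by rewrite /dot -big_split; apply: eq_bigr => i _; rewrite mxE mulrDl. Qed.

Lemma dotZl a x y : dot (a *: x) y = a * dot x y.
Proof. by rewrite /dot mulr_sumr; apply: eq_bigr => i _; rewrite mxE mulrA. Qed.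

Lemma dotDr x y z : dot x (y + z) = dot x y + dot x z.
Proof. by rewrite dotC dotDl !(dotC x). Qed.

Lemma dotZr a x y : dot x (a *: y) = a * dot x y.
Proof. by rewrite dotC dotZl dotC. Qed.

Lemma dotNl x y : dot (- x) y = - dot x y.
Proof. by rewrite -scaleN1r dotZl mulN1r. Qed.

Lemma dotNr x y : dot x (- y) = - dot x y.
Proof. by rewrite dotC dotNl dotC. Qed.

Lemma dotBl x y z : dot (x - y) z = dot x z - dot y z.
Proof. by rewrite dotDl dotNl. Qed.

Lemma dotBr x y z : dot x (y - z) = dot x y - dot x z.
Proof. by rewrite dotDr dotNr. Qed.

Lemma dot0l x : dot 0 x = 0.
Proof. by rewrite -(scale0r 0) dotZl mul0r. Qed.

Lemma dot0r x : dot x 0 = 0.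
Proof. by rewrite dotC dot0l. Qed.

Lemma dot_sumr (I : finType) (P : pred I) (F : I -> 'rV[R]_d) x :
  dot x (\sum_(i | P i) F i) = \sum_(i | P i) dot x (F i).
Proof.
by apply: (big_morph (dot x)); [move=> u v; rewrite dotDr | rewrite dot0r].
Qed.

Lemma dotxx_ge0 x : 0 <= dot x x.
Proof. by apply: sumr_ge0 => i _; rewrite -expr2 sqr_ge0. Qed.

Lemma enorm_ge0 x : 0 <= enorm x.
Proof. exact: sqrtr_ge0. Qed.

Lemma enorm_sqr x : enorm x ^+ 2 = dot x x.
Proof.
rewrite sqr_sqrtr; first by apply: eq_bigr => i _; rewrite expr2.
by apply: sumr_ge0 => i _; rewrite sqr_ge0.
Qed.

Lemma dotE x : dot x x = enorm x ^+ 2.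
Proof. by rewrite enorm_sqr. Qed.

Lemma enorm_eq0 x : (enorm x == 0) = (x == 0).
Proof.
apply/idP/eqP => [|->]; last first.
  by rewrite -sqrf_eq0 enorm_sqr dot0l.
rewrite -sqrf_eq0 enorm_sqr psumr_eq0 => [/allP h|i _]; last first.
  by rewrite -expr2 sqr_ge0.
apply/rowP => i; rewrite mxE.
have := h i (mem_index_enum i); rewrite implyTb -expr2 sqrf_eq0.
by move/eqP.
Qed.

Lemma enorm0 : enorm (0 : 'rV[R]_d) = 0.
Proof. by apply/eqP; rewrite enorm_eq0. Qed.

Lemma enorm_gt0 x : (0 < enorm x) = (x != 0).
Proof. by rewrite lt_neqAle enorm_ge0 andbT eq_sym enorm_eq0. Qed.

Lemma enormZ a x : enorm (a *: x) = `|a| * enorm x.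
Proof.
apply/eqP; rewrite -(@eqrXn2 _ 2) ?mulr_ge0 ?enorm_ge0//.
by rewrite enorm_sqr dotZl dotZr exprMn real_normK ?num_real// enorm_sqr mulrA.
Qed.

Lemma enormN x : enorm (- x) = enorm x.
Proof. by rewrite -scaleN1r enormZ normrN1 mul1r. Qed.

Lemma enormB x y : enorm (x - y) = enorm (y - x).
Proof. by rewrite -enormN opprB. Qed.

Lemma dot_le x y : dot x y <= enorm x * enorm y.
Proof.
have [->|x0] := eqVneq x 0; first by rewrite dot0l enorm0 mul0r.
have [->|y0] := eqVneq y 0; first by rewrite dot0r enorm0 mulr0.
have hx : 0 < enorm x by rewrite enorm_gt0.
have hy : 0 < enorm y by rewrite enorm_gt0.
have := dotxx_ge0 (enorm y *: x - enorm x *: y).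
rewrite !(dotBl, dotBr, dotZl, dotZr) !dotE (dotC y x) => h.
have h2 : 0 <= (enorm x * enorm y) * (enorm x * enorm y - dot x y).
  by nra.
by rewrite pmulr_rge0 ?mulr_gt0// subr_ge0 in h2.
Qed.

Lemma normr_dot_le x y : `|dot x y| <= enorm x * enorm y.
Proof.
by rewrite ler_norml dot_le andbT lerNl -dotNl -(enormN x) dot_le.
Qed.

Lemma enormD x y : enorm (x + y) <= enorm x + enorm y.
Proof.
rewrite -(@ler_pXn2r _ 2) ?nnegrE ?addr_ge0 ?enorm_ge0//.
rewrite enorm_sqr !(dotDl, dotDr) !dotE (dotC y x).
have := dot_le x y; nra.
Qed.

Lemma enorm_triangle x y z : enorm (x - z) <= enorm (x - y) + enorm (y - z).
Proof. by rewrite (le_trans _ (enormD _ _))// addrA subrK. Qed.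

Lemma enorm_sum (I : finType) (P : pred I) (F : I -> 'rV[R]_d) :
  enorm (\sum_(i | P i) F i) <= \sum_(i | P i) enorm (F i).
Proof.
elim/big_rec2 : _ => [|i u v _ h]; first by rewrite enorm0.
by rewrite (le_trans (enormD _ _))// lerD2l.
Qed.

Lemma normr_coord_le x i : `|x 0 i| <= enorm x.
Proof.
rewrite -(@ler_pXn2r _ 2) ?nnegrE ?enorm_ge0// real_normK ?num_real//.
rewrite enorm_sqr /dot (bigD1 i)//= -expr2 lerDl.
by apply: sumr_ge0 => j _; rewrite -expr2 sqr_ge0.
Qed.

Lemma enorm_le_sum x : enorm x <= \sum_(i < d) `|x 0 i|.
Proof.
have -> : x = \sum_(i < d) x 0 i *: delta_mx 0 i by exact: row_sum_delta.
apply: (le_trans (enorm_sum _ _)); rewrite -row_sum_delta.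
apply: ler_sum => i _; rewrite enormZ -[leRHS]mulr1.
apply: ler_wpM2l => //; rewrite -(@ler_pXn2r _ 2) ?nnegrE ?enorm_ge0//.
rewrite enorm_sqr /dot (bigD1 i)//= big1 ?addr0 => [|j ji]; last first.
  by rewrite !mxE eqxx /= (negbTE ji) mulr0.
by rewrite !mxE !eqxx mulr1 expr1n.
Qed.

Lemma enorm_le_norm x : enorm x <= d%:R * `|x|.
Proof.
apply: (le_trans (enorm_le_sum x)).
rewrite -[X in X%:R]card_ord -sum1_card natr_sum mulr_suml ler_sum// => i _.
by rewrite mul1r [leRHS]mx_normrE (le_bigmax _ (fun k => `|x k.1 k.2|) (0, i)).
Qed.

Lemma norm_le_enorm x : `|x| <= enorm x.
Proof.
rewrite [leLHS]mx_normrE; apply: bigmax_le; first exact: enorm_ge0.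
by move=> [i j] _; rewrite (ord1 i) normr_coord_le.
Qed.

(** The sup norm defines the topology; all topological arguments go through
    Euclidean balls instead. *)
Lemma nbhs_enormP x (A : set 'rV[R]_d) :
  nbhs x A <-> exists2 e, 0 < e & forall y, enorm (y - x) < e -> A y.
Proof.
split=> [/nbhs_ballP[e /= e0 h]|[e e0 h]].
  exists e => // y hy; apply: h; rewrite -ball_normE /= distrC.
  exact: le_lt_trans (norm_le_enorm _) hy.
apply/nbhs_ballP; exists (e / (d.+1)%:R) => /=; first by rewrite divr_gt0.
move=> y; rewrite -ball_normE /= distrC ltr_pdivlMr// => hy; apply: h.
apply: le_lt_trans (enorm_le_norm _) _; apply: le_lt_trans hy.
by rewrite mulrC ler_wpM2l// ler_nat.
Qed.

Lemma closure_enormP x (A : set 'rV[R]_d) :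
  closure A x <-> forall e, 0 < e -> exists2 y, A y & enorm (y - x) < e.
Proof.
split=> [h e e0|h B /nbhs_enormP[e e0 he]].
  have /h[y [Ay hy]] : nbhs x [set y | enorm (y - x) < e].
    by apply/nbhs_enormP; exists e.
  by exists y.
by have [y Ay hy] := h e e0; exists y; split => //; exact: he.
Qed.

Lemma interior_enormP x (A : set 'rV[R]_d) :
  interior A x <-> exists2 e, 0 < e & forall y, enorm (y - x) < e -> A y.
Proof. exact: nbhs_enormP. Qed.

Lemma dist_continuous p : continuous (fun x => enorm (x - p)).
Proof.
move=> x; apply/(@cvgrPdist_lt _ _ _ (nbhs x)) => e e0.
apply/nbhs_enormP; exists e => // y hy; rewrite /= ltr_norml.
have := enorm_triangle x y p; have := enorm_triangle y x p.
rewrite (enormB x y); lra.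
Qed.

Lemma dot_continuous z : continuous (dot z).
Proof.
move=> x; apply/(@cvgrPdist_lt _ _ _ (nbhs x)) => e e0.
apply/nbhs_enormP; exists (e / (enorm z + 1)) => [|y] /=.
  by rewrite divr_gt0// ltr_wpDl ?enorm_ge0.
rewrite ltr_pdivlMr ?ltr_wpDl ?enorm_ge0// -dotBr => hy.
apply: le_lt_trans (normr_dot_le _ _) _; apply: le_lt_trans hy.
rewrite enormB mulrC ler_wpM2l ?enorm_ge0//; lra.
Qed.

Lemma bounded_enorm (A : set 'rV[R]_d) :
  bounded_set A -> exists2 r, 0 < r & forall x, A x -> enorm x <= r.
Proof.
move=> [M [Mr h]]; exists (d%:R * (`|M| + 1) + 1) => [|x Ax].
  by rewrite ltr_wpDl// mulr_ge0.
have /(_ _)/(_ x Ax)/= hx := h (`|M| + 1).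
apply: (le_trans (enorm_le_norm x)); rewrite ler_wpDr// ler_wpM2l//.
by apply: hx; rewrite ltr_pwDr// ler_norm.
Qed.

Lemma enorm_bounded (A : set 'rV[R]_d) r :
  (forall x, A x -> enorm x <= r) -> bounded_set A.
Proof.
move=> h; exists r; split; first exact: num_real.
move=> M rM x Ax; apply: le_trans (norm_le_enorm _) _.
exact: le_trans (h x Ax) (ltW rM).
Qed.

Lemma within_continuousP (A : set 'rV[R]_d) (g : 'rV[R]_d -> R) :
  {within A, continuous g} <->
  forall x, A x -> forall e, 0 < e ->
    exists2 r, 0 < r & forall y, A y -> enorm (y - x) < r -> `|g y - g x| < e.
Proof.
split=> [/subspace_continuousP h x Ax e e0|h].
  have /cvgrPdist_lt/(_ e e0) := h x Ax.
  rewrite near_withinE => /nbhs_enormP[r r0 hr].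
  by exists r => // y Ay hy; rewrite distrC; exact: hr.
apply/subspace_continuousP => x Ax; apply/cvgrPdist_lt => e e0.
rewrite near_withinE; apply/nbhs_enormP; have [r r0 hr] := h x Ax e e0.
by exists r => // y hy Ay; rewrite distrC; exact: hr.
Qed.

End Euclidean.

(** * Convex combinations, nearest points and separation *)

Section Convexity.
Context {R : realType} {n : nat}.
Implicit Types (P : set 'rV[R]_n) (x y p q : 'rV[R]_n).

Definition combinations (N : nat) P : set 'rV[R]_n :=
  [set q | exists (c : 'I_N -> R) (Y : 'I_N -> 'rV[R]_n),
    [/\ forall j, 0 <= c j, \sum_j c j = 1, forall j, P (Y j) &
        q = \sum_j c j *: Y j]].

Lemma combinations_add N P q y t : combinations N P q -> P y -> 0 <= t <= 1 ->
  combinations N.+1 P ((1 - t) *: q + t *: y).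
Proof.
move=> [c [Y [c0 c1 PY ->]]] Py /andP[t0 t1].
exists (fun j => if unlift ord0 j is Some k then (1 - t) * c k else t).
exists (fun j => if unlift ord0 j is Some k then Y k else y); split.
- by move=> j; case: unlift => // k; rewrite mulr_ge0// subr_ge0.
- rewrite big_ord_recl unlift_none.
  under eq_bigr do rewrite liftK.
  by rewrite -mulr_sumr c1 mulr1 addrC subrK.
- by move=> j; case: unlift.
- rewrite big_ord_recl unlift_none addrC; congr (_ + _).
  under [RHS]eq_bigr do rewrite liftK -scalerA.
  by rewrite scaler_sumr.
Qed.

Lemma combinations_split N P q : combinations N.+2 P q ->
  exists t a y, [/\ 0 <= t <= 1, combinations N.+1 P a, P y &
                    q = (1 - t) *: a + t *: y].
Proof.
move=> [c [Y [c0 c1 PY ->]]].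
rewrite big_ord_recl in c1.
have s0 : 0 <= \sum_(i < N.+1) c (lift ord0 i) by apply: sumr_ge0.
have t1 : 1 - c ord0 = \sum_(i < N.+1) c (lift ord0 i) by rewrite -c1 addrC addKr.
have [s_eq0|s_neq0] := eqVneq (1 - c ord0) 0.
  exists 1, (Y ord0), (Y ord0); split => //; first by rewrite ler01 lexx.
    exists (fun j => (j == ord0)%:R), (fun=> Y ord0); split => //.
    - by rewrite (bigD1 ord0)//= big1 ?addr0// => i /negbTE ->.
    - rewrite (bigD1 ord0)//= big1 ?addr0 ?scale1r// => i /negbTE ->.
      by rewrite scale0r.
  rewrite subrr scale0r add0r big_ord_recl big1 ?addr0 => [|i _].
    by congr (_ *: _); apply/eqP; rewrite -subr_eq0 -oppr_eq0 opprB s_eq0.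
  have : \sum_(i < N.+1) c (lift ord0 i) == 0 by rewrite -t1 s_eq0.
  rewrite psumr_eq0// => /allP/(_ i (mem_index_enum _))/=/eqP ->.
  by rewrite scale0r.
have s_gt0 : 0 < 1 - c ord0 by rewrite lt_neqAle eq_sym s_neq0 t1.
exists (c ord0), (\sum_(i < N.+1) (c (lift ord0 i) / (1 - c ord0)) *: Y (lift ord0 i)).
exists (Y ord0); split => //.
- by rewrite c0 -subr_ge0 ltW.
- exists (fun i => c (lift ord0 i) / (1 - c ord0)), (fun i => Y (lift ord0 i)).
  split => // [j|]; first by rewrite divr_ge0// ltW.
  by rewrite -mulr_suml -t1 divff.
- rewrite big_ord_recl addrC; congr (_ + _); rewrite scaler_sumr.
  by apply: eq_bigr => i _; rewrite scalerA mulrCA divff// mulr1.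
Qed.

Lemma combinations_compact N P : compact P -> compact (combinations N.+1 P).
Proof.
move=> cP; elim: N => [|N IH].
  suff -> : combinations 1 P = P by [].
  apply/seteqP; split => [q [c [Y [_ c1 PY ->]]]|q Pq].
    by move: c1; rewrite !big_ord1 => ->; rewrite scale1r.
  exists (fun=> 1), (fun=> q); split => //; first by rewrite big_ord1.
  by rewrite big_ord1 scale1r.
pose g (z : R * ('rV[R]_n * 'rV[R]_n)) := (1 - z.1) *: z.2.1 + z.1 *: z.2.2.
have -> : combinations N.+2 P =
          g @` (`[0, 1]%classic `*` (combinations N.+1 P `*` P)).
  apply/seteqP; split => [q /combinations_split[t [a [y [t01 ha Py ->]]]]|q].
    by exists (t, (a, y)) => //=; split => //=; rewrite in_itv.
  move=> [[t [a y]] [/= t01 [ha Py]] <-].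
  by apply: combinations_add => //; move: t01; rewrite in_itv.
apply: continuous_compact; last first.
  by apply: compact_setX; [exact: segment_compact | exact: compact_setX].
apply: continuous_subspaceT => z; apply: cvgD; apply: cvgZ.
- by apply: cvgB; [exact: cvg_cst | exact: cvg_fst].
- by apply: (@continuous_comp _ _ _ snd fst); [exact: cvg_snd | exact: cvg_fst].
- exact: cvg_fst.
- by apply: (@continuous_comp _ _ _ snd snd); [exact: cvg_snd | exact: cvg_snd].
Qed.

Lemma combinations_drop N P (c : 'I_N.+1 -> R) (Y : 'I_N.+1 -> 'rV[R]_n) j :
  (forall k, 0 <= c k) -> \sum_k c k = 1 -> (forall k, P (Y k)) -> c j = 0 ->
  combinations N P (\sum_k c k *: Y k).
Proof.
move=> c0 c1 PY cj; exists (fun k => c (lift j k)), (fun k => Y (lift j k)).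
split => //; last by rewrite (bigD1_ord j)//= cj scale0r add0r.
by move: c1; rewrite (bigD1_ord j)//= cj add0r.
Qed.

(** One step of Caratheodory's theorem: n + 2 points of an n-dimensional space
    are affinely dependent, and moving the weights along a dependence until the
    first of them vanishes frees one point. *)
Lemma combinations_reduce P : combinations n.+2 P `<=` combinations n.+1 P.
Proof.
move=> q [c [Y [c0 c1 PY ->]]].
pose A : 'M[R]_(n.+2, n + 1) := \matrix_j row_mx (Y j) (1%:M : 'rV_1).
have /rowV0Pn[v /sub_kermxP vA v0] : kermx A != 0.
  rewrite kermx_eq0 /row_free; apply: contraTN (rank_leq_col A) => /eqP ->.
  by rewrite -ltnNge addn1.
have rowA : v *m A = \sum_j v 0 j *: row_mx (Y j) (1%:M : 'rV_1).
  by rewrite mulmx_sum_row; apply: eq_bigr => j _; rewrite rowK.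
have vY : \sum_j v 0 j *: Y j = 0.
  have := congr1 lsubmx rowA; rewrite vA linear0 linear_sum/= => /esym.
  by under eq_bigr do rewrite linearZ/= row_mxKl.
have v1 : \sum_j v 0 j = 0.
  have := congr1 rsubmx rowA; rewrite vA linear0 linear_sum/=.
  under eq_bigr do rewrite linearZ/= row_mxKr.
  move=> /(congr1 (fun M : 'rV_1 => M 0 0)); rewrite summxE mxE => /esym.
  by move=> h; rewrite -[RHS]h; apply: eq_bigr => j _; rewrite !mxE mulr1.
have [j0 vj0] : exists j, 0 < v 0 j.
  apply/not_existsP => h.
  have h' j : 0 <= - v 0 j by rewrite oppr_ge0 leNgt; apply/negP/h.
  move/eqP: v0; apply; apply/rowP => j; rewrite mxE.
  have /eqP : \sum_j - v 0 j = 0 by rewrite sumrN v1 oppr0.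
  rewrite psumr_eq0// => /allP/(_ j (mem_index_enum _))/=.
  by rewrite oppr_eq0 => /eqP.
have [j vj jmin] := @arg_minP _ _ _ j0 (fun j => 0 < v 0 j) (fun j => c j / v 0 j) vj0.
pose t := c j / v 0 j.
have t0 : 0 <= t by rewrite divr_ge0// ltW.
pose c' k := c k - t * v 0 k.
have -> : \sum_k c k *: Y k = \sum_k c' k *: Y k.
  apply/esym; under eq_bigr do rewrite scalerBl -scalerA.
  by rewrite sumrB -scaler_sumr vY scaler0 subr0.
apply: (@combinations_drop _ _ c' Y j) => //.
- move=> k; rewrite subr_ge0; have [vk|vk] := ltP 0 (v 0 k).
    by rewrite -ler_pdivlMr//; exact: jmin.
  by apply: le_trans (c0 k); rewrite mulr_ge0_le0.
- by rewrite sumrB -mulr_sumr v1 mulr0 subr0.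
- by rewrite /c' /t divfK ?subrr// gt_eqF.
Qed.

Lemma nearest_point P p : compact P -> P !=set0 ->
  exists2 q, P q & forall y, P y -> enorm (q - p) <= enorm (y - p).
Proof.
move=> cP P0.
have [|q] := @EVT_min_rV _ _ (fun y => enorm (y - p)) P P0 cP.
  by apply: continuous_subspaceT; exact: dist_continuous.
by rewrite inE => Pq h; exists q => // y Py; apply: h; rewrite inE.
Qed.

(** First variation of the squared distance at a nearest point. *)
Lemma nearest_obtuse x y :
  (forall t : R, 0 < t <= 1 -> enorm x <= enorm (x + t *: y)) -> 0 <= dot x y.
Proof.
move=> h; rewrite leNgt; apply/negP => xy.
have y2 : 0 <= dot y y := dotxx_ge0 y.
pose t := - dot x y / (- dot x y + dot y y).
have den : 0 < - dot x y + dot y y by lra.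
have t0 : 0 < t by rewrite divr_gt0// oppr_gt0.
have t1 : t <= 1 by rewrite ler_pdivrMr//; lra.
have /h : 0 < t <= 1 by rewrite t0.
rewrite -(@ler_pXn2r _ 2) ?nnegrE ?enorm_ge0// !enorm_sqr.
rewrite !(dotDl, dotDr, dotZl, dotZr) (dotC y x).
have te : t * (- dot x y + dot y y) = - dot x y by rewrite divfK// gt_eqF.
nra.
Qed.

Lemma convex_hull_separation P p : compact P -> P !=set0 ->
  ~ combinations n.+1 P p ->
  exists a eta, 0 < eta /\ forall y, P y -> eta <= dot a (y - p).
Proof.
move=> cP [y0 Py0] np.
have [|q Cq qmin] := nearest_point p (combinations_compact (N := n) cP).
  exists y0, (fun j => (j == ord0)%:R), (fun=> y0); split => //.
  - by rewrite (bigD1 ord0)//= big1 ?addr0// => i /negbTE ->.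
  - rewrite (bigD1 ord0)//= big1 ?addr0 ?scale1r// => i /negbTE ->.
    by rewrite scale0r.
exists (q - p), (enorm (q - p) ^+ 2); split.
  rewrite exprn_gt0// enorm_gt0 subr_eq0; apply/eqP => qp.
  by apply: np; rewrite -qp.
move=> y Py; have : 0 <= dot (q - p) (y - q).
  apply: nearest_obtuse => t /andP[t0 t1].
  have -> : q - p + t *: (y - q) = ((1 - t) *: q + t *: y) - p.
    by apply/rowP => i; rewrite !mxE; ring.
  apply: qmin; apply: combinations_reduce; apply: combinations_add => //.
  by rewrite (ltW t0).
have -> : y - p = (y - q) + (q - p) by rewrite addrA subrK.
by rewrite [X in _ -> _ <= X]dotDr dotE lerDr.
Qed.

End Convexity.

(** * The convex envelope and its contact points *)

Section ConvexFacts.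
Context {R : realType} {d : nat}.
Implicit Types (A Omega : set 'rV[R]_d) (x y : 'rV[R]_d).

Lemma affine_functionP (l : 'rV[R]_d -> R) :
  affine_function l <-> exists a b, forall x, l x = dot a x + b.
Proof. by []. Qed.

Lemma affine_combination (l : 'rV[R]_d -> R) (I : finType) (c : I -> R)
    (Y : I -> 'rV[R]_d) : affine_function l -> \sum_j c j = 1 ->
  l (\sum_j c j *: Y j) = \sum_j c j * l (Y j).
Proof.
move=> /affine_functionP[a [b lE]] c1; rewrite lE dot_sumr.
rewrite -[X in _ + X]mul1r -c1 mulr_suml -big_split; apply: eq_bigr => j _.
by rewrite lE mulrDr dotZr.
Qed.

Lemma combinations_convex A N :
  (forall x y t, A x -> A y -> 0 <= t <= 1 -> A ((1 - t) *: x + t *: y)) ->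
  combinations N A `<=` A.
Proof.
move=> cA; case: N => [q [c [Y [_ c1 _ _]]]|N].
  by move: c1; rewrite big_ord0 => /esym/eqP; rewrite oner_eq0.
elim: N => [|N IH] q.
  by move=> [c [Y [_ c1 AY ->]]]; move: c1; rewrite !big_ord1 => ->; rewrite scale1r.
by move=> /combinations_split[t [a [y [t01 /IH Aa Ay ->]]]]; exact: cA.
Qed.

Lemma enorm_row_mx_le x (b : R) :
  enorm (row_mx x (b%:M : 'rV_1)) <= enorm x + `|b|.
Proof.
rewrite -(@ler_pXn2r _ 2) ?nnegrE ?addr_ge0 ?enorm_ge0//.
rewrite enorm_sqr /dot big_split_ord/= big_ord1 row_mxEr mxE eqxx mulr1n.
under eq_bigr do rewrite row_mxEl.
rewrite -/(dot x x) dotE -expr2 -(real_normK (num_real b)).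
have := mulr_ge0 (enorm_ge0 x) (normr_ge0 b); nra.
Qed.

Lemma large_weight N (c : 'I_N.+1 -> R) : \sum_j c j = 1 ->
  exists j, (N.+1)%:R^-1 <= c j.
Proof.
move=> c1; apply/not_existsP => h.
have : \sum_j c j < \sum_(j < N.+1) (N.+1)%:R^-1.
  apply: ltr_sum => [|j _]; last by rewrite ltNge; apply/negP/h.
  by apply/hasP; exists ord0; rewrite ?mem_index_enum.
by rewrite c1 sumr_const card_ord -[X in _ < X]mulr_natr mulVf ?pnatr_eq0// ltxx.
Qed.

Lemma closure_compact Omega : bounded_set Omega -> compact (closure Omega).
Proof.
move=> /bounded_enorm[r r0 hr]; apply: bounded_closed_compact; last exact: closed_closure.
apply: (@enorm_bounded _ _ _ (r + 1)) => x /closure_enormP/(_ 1 ltr01)[y Oy hy].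
have := enorm_triangle x y 0; rewrite !subr0 (enormB x).
have := hr y Oy; lra.
Qed.

Lemma strictly_convex_closure Omega : strictly_convex Omega ->
  forall x y t, closure Omega x -> closure Omega y -> 0 <= t <= 1 ->
    closure Omega ((1 - t) *: x + t *: y).
Proof.
move=> sc x y t cx cy /andP[t0 t1].
have [->|xy] := eqVneq x y; first by rewrite -scalerDl subrK scale1r.
have [->|t_neq0] := eqVneq t 0; first by rewrite subr0 scale1r scale0r addr0.
have [->|t_neq1] := eqVneq t 1; first by rewrite subrr scale1r scale0r add0r.
apply: subset_closure; rewrite addrC; apply: sc => //; first by rewrite eq_sym.
by rewrite !lt_neqAle eq_sym t_neq0 t0 t_neq1 t1.
Qed.

Lemma strictly_convex_open_segment Omega x y t : strictly_convex Omega ->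
  Omega x -> closure Omega y -> 0 <= t < 1 -> Omega (x + t *: (y - x)).
Proof.
move=> sc Ox cy /andP[t0 t1].
have [<-|xy] := eqVneq x y; first by rewrite subrr scaler0 addr0.
have [->|t_neq0] := eqVneq t 0; first by rewrite scale0r addr0.
have -> : x + t *: (y - x) = t *: y + (1 - t) *: x.
  by apply/rowP => i; rewrite !mxE; ring.
apply: sc => //; [exact: subset_closure | by rewrite eq_sym |].
by rewrite t1 lt_neqAle eq_sym t_neq0 t0.
Qed.

(** If a weight c j is less than 1, the combination lies on the open segment
    between Y j and the normalized rest, which strict convexity puts inside Omega
    unless the two points coincide. *)
Lemma strictly_convex_extreme Omega N (c : 'I_N.+1 -> R)
    (Y : 'I_N.+1 -> 'rV[R]_d) :
  strictly_convex Omega -> (forall j, 0 <= c j) -> \sum_j c j = 1 ->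
  (forall j, closure Omega (Y j)) -> ~ Omega (\sum_j c j *: Y j) ->
  forall j, 0 < c j -> Y j = \sum_k c k *: Y k.
Proof.
move=> sc c0 c1 OY nO j cj.
have s1 : \sum_(i < N) c (lift j i) = 1 - c j.
  by apply/eqP; rewrite eq_sym subr_eq addrC -c1 (bigD1_ord j).
have [cj1|cj_neq1] := eqVneq (1 - c j) 0.
  rewrite (bigD1_ord j)//= big1 ?addr0 => [|i _].
    by rewrite -[X in X *: _](subKr 1) cj1 subr0 scale1r.
  have /eqP := s1; rewrite cj1 psumr_eq0// => /allP/(_ i (mem_index_enum _))/=/eqP ->.
  by rewrite scale0r.
have cj1 : 0 < 1 - c j by rewrite lt_neqAle eq_sym cj_neq1 -s1 sumr_ge0.
pose z := \sum_(i < N) (c (lift j i) / (1 - c j)) *: Y (lift j i).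
have Oz : closure Omega z.
  apply: (combinations_convex (strictly_convex_closure sc)).
  exists (fun i => c (lift j i) / (1 - c j)), (fun i => Y (lift j i)).
  split => // [i|]; first by rewrite divr_ge0// ltW.
  by rewrite -mulr_suml s1 divff.
have E : \sum_k c k *: Y k = c j *: Y j + (1 - c j) *: z.
  rewrite (bigD1_ord j)//= scaler_sumr; congr (_ + _); apply: eq_bigr => i _.
  by rewrite scalerA mulrCA divff// mulr1.
have [zY|zY] := eqVneq (Y j) z.
  by rewrite E -zY -scalerDl addrC subrK scale1r.
exfalso; apply: nO; rewrite E; apply: sc => //.
by rewrite cj -subr_gt0.
Qed.

End ConvexFacts.

Section Envelope.
Context {R : realType} {d : nat}.
Variables (Omega : set 'rV[R]_d) (f : 'rV[R]_d -> R).
Hypothesis bOmega : bounded_set Omega.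
Hypothesis cf : {within closure Omega, continuous f}.
Let u := convex_envelope Omega f.
Implicit Types x y : 'rV[R]_d.

Let minorant x := [set l x | l in [set l : 'rV[R]_d -> R |
  affine_function l /\ forall y, closure Omega y -> l y <= f y]].

Let minorant_nonempty x : minorant x !=set0.
Proof.
have [cO0|/set0P cO0] := eqVneq (closure Omega) set0.
  exists 0, (fun=> 0) => //; split; last by rewrite cO0.
  by apply/affine_functionP; exists 0, 0 => y; rewrite dot0l addr0.
have [y _ ymin] := EVT_min_rV cO0 (closure_compact bOmega) cf.
exists (f y), (fun=> f y) => //; split; last by move=> z Oz; apply: ymin; rewrite inE.
by apply/affine_functionP; exists 0, (f y) => z; rewrite dot0l add0r.
Qed.

Lemma minorant_le_envelope (l : 'rV[R]_d -> R) x :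
  affine_function l -> (forall y, closure Omega y -> l y <= f y) ->
  closure Omega x -> l x <= u x.
Proof.
move=> al lf Ox; apply: ub_le_sup; last by exists l.
by exists (f x) => _ [l' [_ l'f] <-]; exact: l'f.
Qed.

Lemma envelope_le x : closure Omega x -> u x <= f x.
Proof.
move=> Ox; apply: ge_sup; first exact: minorant_nonempty.
by move=> _ [l [_ lf] <-]; exact: lf.
Qed.

Lemma envelope_convex (I : finType) (c : I -> R) (Y : I -> 'rV[R]_d) :
  (forall j, 0 <= c j) -> \sum_j c j = 1 -> (forall j, closure Omega (Y j)) ->
  u (\sum_j c j *: Y j) <= \sum_j c j * u (Y j).
Proof.
move=> c0 c1 OY; apply: ge_sup; first exact: minorant_nonempty.
move=> _ [l [al lf] <-]; rewrite affine_combination//.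
by apply: ler_sum => j _; rewrite ler_wpM2l// minorant_le_envelope.
Qed.

Lemma envelope_midpoint x w : closure Omega (x + w) -> closure Omega (x - w) ->
  2 * u x <= u (x + w) + u (x - w).
Proof.
move=> h1 h2.
have := @envelope_convex bool (fun=> 2^-1) (fun b => if b then x + w else x - w).
rewrite !big_bool/= => h; have {h} : u (2^-1 *: (x + w) + 2^-1 *: (x - w)) <=
    2^-1 * u (x + w) + 2^-1 * u (x - w).
  by apply: h => [j| |[]//]; rewrite ?invr_ge0//; lra.
have -> : 2^-1 *: (x + w) + 2^-1 *: (x - w) = x.
  by apply/rowP => i; rewrite !mxE; lra.
lra.
Qed.

(** The graph point (x, u x) lies in the convex hull of the graph of f. A
    separating functional with positive last coefficient would give an affine
    minorant of f above u x at x, and one with nonpositive last coefficient is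
    excluded by the graph point over x itself. *)
Lemma envelope_representation x : closure Omega x ->
  exists (c : 'I_(d + 1).+1 -> R) (Y : 'I_(d + 1).+1 -> 'rV[R]_d),
    [/\ forall j, 0 <= c j, \sum_j c j = 1, forall j, closure Omega (Y j),
        x = \sum_j c j *: Y j & u x = \sum_j c j * f (Y j)].
Proof.
move=> Ox; pose g y : 'rV[R]_(d + 1) := row_mx y (f y)%:M.
pose p : 'rV[R]_(d + 1) := row_mx x (u x)%:M.
have cg : {within closure Omega, continuous g}.
  apply/subspace_continuousP => y Oy; apply/cvgrPdist_lt => e e0.
  rewrite near_withinE; apply/nbhs_enormP.
  have e20 : 0 < e / 2 by lra.
  have [r r0 hr] := (within_continuousP _ _).1 cf y Oy _ e20.
  exists (Num.min r (e / 2)) => [|z]; first by rewrite lt_min r0.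
  rewrite lt_min => /andP[zr ze] Oz; rewrite -normrN opprB.
  apply: le_lt_trans (norm_le_enorm _) _.
  rewrite /g opp_row_mx add_row_mx -raddfB/=.
  apply: le_lt_trans (enorm_row_mx_le _ _) _; have := hr z Oz zr; lra.
have [|np] := pselect (combinations (d + 1).+1 (g @` closure Omega) p).
  move=> [c [Y [c0 c1 PY pE]]].
  pose Z j := xget 0 [set y | closure Omega y /\ g y = Y j].
  have hZ j : closure Omega (Z j) /\ g (Z j) = Y j.
    have [y Oy gy] := PY j.
    by apply: (@xgetPex _ 0 [set y | closure Omega y /\ g y = Y j]); exists y.
  exists c, Z; split => // [j||].
  - by have [] := hZ j.
  - have := congr1 lsubmx pE; rewrite row_mxKl linear_sum => ->.
    by apply: eq_bigr => j _; rewrite linearZ/= -(hZ j).2 row_mxKl.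
  - have := congr1 (fun q : 'rV_(d + 1) => rsubmx q 0 0) pE.
    rewrite row_mxKr mxE eqxx mulr1n => ->.
    rewrite linear_sum summxE; apply: eq_bigr => j _.
    by rewrite linearZ/= -(hZ j).2 row_mxKr !mxE eqxx mulr1n.
exfalso.
have [|||a [eta [eta0 sep]]] := @convex_hull_separation _ _ (g @` closure Omega) p.
- exact: (continuous_compact cg (closure_compact bOmega)).
- by exists (g x), x.
- exact: np.
pose a1 := lsubmx a; pose tau := rsubmx a 0 0.
have {}sep y : closure Omega y -> eta <= dot a1 (y - x) + tau * (f y - u x).
  move=> Oy; suff -> : dot a1 (y - x) + tau * (f y - u x) = dot a (g y - p).
    by apply: sep; exists y.
  have -> : g y - p = row_mx (y - x) (f y - u x)%:M.
    by rewrite /g /p opp_row_mx add_row_mx -raddfB.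
  rewrite [RHS]big_split_ord/= big_ord1 row_mxEr [_%:M 0 0]mxE eqxx mulr1n.
  congr (_ + _); last by rewrite /tau mxE.
  by apply: eq_bigr => i _; rewrite row_mxEl /a1 mxE.
have := sep x Ox; rewrite subrr dot0r add0r => hx.
have tau0 : 0 < tau.
  have := envelope_le Ox; rewrite -subr_ge0 => fu.
  by rewrite ltNge; apply/negP => tau0; have := mulr_le0_ge0 tau0 fu; lra.
pose l y := dot (- tau^-1 *: a1) y + (u x + (eta + dot a1 x) / tau).
have : l x <= u x.
  apply: minorant_le_envelope => //.
    by apply/affine_functionP; exists (- tau^-1 *: a1), (u x + (eta + dot a1 x) / tau).
  move=> y Oy; have := sep y Oy; rewrite /l dotBr dotZl => h.
  have kt : tau^-1 * tau = 1 by rewrite mulVf// gt_eqF.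
  have k0 : 0 <= tau^-1 by rewrite invr_ge0 ltW.
  by have := ler_wpM2l k0 h; rewrite mulrDr mulrA kt mul1r; lra.
rewrite /l dotZl; have := divr_gt0 eta0 tau0; lra.
Qed.

End Envelope.

Section EnvelopeContact.
Context {R : realType} {d : nat}.
Variables (Omega : set 'rV[R]_d) (f : 'rV[R]_d -> R).
Hypothesis bOmega : bounded_set Omega.
Hypothesis cf : {within closure Omega, continuous f}.
Let u := convex_envelope Omega f.
Implicit Types x y : 'rV[R]_d.

(** Convexity of u makes the weighted sum of the gaps f - u nonpositive, while
    each gap is nonnegative. *)
Lemma representation_contact N (c : 'I_N -> R) (Y : 'I_N -> 'rV[R]_d) :
  (forall j, 0 <= c j) -> \sum_j c j = 1 -> (forall j, closure Omega (Y j)) ->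
  u (\sum_j c j *: Y j) = \sum_j c j * f (Y j) ->
  forall j, 0 < c j -> u (Y j) = f (Y j).
Proof.
move=> c0 c1 OY uE j cj.
have gap k : 0 <= c k * (f (Y k) - u (Y k)).
  by rewrite mulr_ge0// subr_ge0 envelope_le.
have : \sum_k c k * (f (Y k) - u (Y k)) == 0.
  rewrite eq_le sumr_ge0// andbT.
  under eq_bigr do rewrite mulrBr; rewrite sumrB -uE subr_le0.
  exact: envelope_convex.
rewrite psumr_eq0// => /allP/(_ j (mem_index_enum _))/=.
by rewrite mulf_eq0 gt_eqF//= subr_eq0 => /eqP.
Qed.

Lemma envelope_boundary x : strictly_convex Omega ->
  closure Omega x -> ~ Omega x -> u x = f x.
Proof.
move=> sc Ox nx; have [c [Y [c0 c1 OY xE uE]]] := envelope_representation bOmega cf Ox.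
rewrite [LHS]uE -[RHS]mul1r -c1 mulr_suml; apply: eq_bigr => j _.
have [cj0|cj_neq0] := eqVneq (c j) 0; first by rewrite cj0 !mul0r.
rewrite (@strictly_convex_extreme _ _ Omega _ c Y)// -?xE//.
by rewrite lt_neqAle eq_sym cj_neq0 c0.
Qed.

(** Of the d + 2 weights in a representation one is at least 1 / (d + 2), so
    that the segment from its point through x stays in the convex hull for at
    least 1 / (d + 1) of its length behind x. Hence either that contact point is
    close to x, or u does not bend at x in its direction. *)
Lemma envelope_dichotomy x rho : closure Omega x -> 0 < rho ->
  (exists y, [/\ closure Omega y, u y = f y & enorm (y - x) < (d + 1)%:R * rho])
  \/ exists2 v, enorm v = 1 & u (x + rho *: v) + u (x - rho *: v) <= 2 * u x.
Proof.
move=> Ox rho0; have [c [Y [c0 c1 OY xE uE]]] := envelope_representation bOmega cf Ox.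
have [j cj] := large_weight c1.
have cj0 : 0 < c j by apply: lt_le_trans cj; rewrite invr_gt0 ltr0n.
have [near|far] := ltP (enorm (Y j - x)) ((d + 1)%:R * rho).
  left; exists (Y j); split => //; apply: (representation_contact c0) => //.
  by rewrite -xE.
right; set r := enorm (Y j - x) in far.
have d0 : 0 < (d + 1)%:R :> R by rewrite ltr0n addn1.
have r0 : 0 < r by apply: lt_le_trans far; rewrite mulr_gt0.
pose tau := rho / r.
have tau0 : 0 < tau by rewrite divr_gt0.
have tau1 : tau * (d + 1)%:R <= 1 by rewrite mulrAC ler_pdivrMr// mul1r mulrC.
have tau2 : tau <= 1.
  by apply: le_trans tau1; rewrite ler_peMr ?(ltW tau0)// ler1n addn1.
have shift t : 0 <= t <= 1 \/ (t <= 0 /\ - t <= (1 - t) * c j) ->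
    u (x + t *: (Y j - x)) <= (1 - t) * u x + t * f (Y j).
  move=> ht; pose m k := (1 - t) * c k + t * (k == j)%:R.
  have m0 k : 0 <= m k.
    rewrite /m; have [->|_] := eqVneq k j; have := c0 k; have := c0 j.
      by rewrite mulr1; case: ht => [/andP[]|[]]; nra.
    by rewrite mulr0 addr0; case: ht => [/andP[]|[]]; nra.
  have sum_m (V : lmodType R) (F : 'I_(d + 1).+1 -> V) :
      \sum_k m k *: F k = (1 - t) *: \sum_k c k *: F k + t *: F j.
    rewrite scaler_sumr [X in _ + X](_ : _ = \sum_k (t * (k == j)%:R) *: F k).
      by rewrite -big_split; apply: eq_bigr => k _; rewrite /= scalerA -scalerDl.
    rewrite (bigD1 j)//= eqxx mulr1 big1 ?addr0// => k /negbTE ->.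
    by rewrite mulr0 scale0r.
  have m1 : \sum_k m k = 1.
    have := sum_m R^o (fun=> 1); under eq_bigr do rewrite [_ *: _]mulr1.
    under [X in _ *: X]eq_bigr do rewrite [_ *: _]mulr1.
    by rewrite c1 => ->; rewrite [X in X + _]mulr1 [X in _ + X]mulr1 subrK.
  have -> : x + t *: (Y j - x) = \sum_k m k *: Y k.
    by rewrite sum_m -xE; apply/rowP => i; rewrite !mxE; ring.
  apply: (le_trans (envelope_convex bOmega cf m0 m1 OY)).
  apply: (@le_trans _ _ (\sum_k m k * f (Y k))).
    by apply: ler_sum => k _; rewrite ler_wpM2l// envelope_le.
  by rewrite [X in (1 - t) * X]uE; have := sum_m R^o (f \o Y); rewrite [RHS]/= => ->.
exists (r^-1 *: (Y j - x)).
  by rewrite enormZ gtr0_norm ?invr_gt0// mulVf// gt_eqF.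
rewrite !scalerA -/tau -scaleNr.
have h1 := shift tau (or_introl _); have {}h1 := h1 (introT andP (conj (ltW tau0) tau2)).
have h2 : u (x + - tau *: (Y j - x)) <= (1 - - tau) * u x + - tau * f (Y j).
  apply: shift; right; rewrite oppr_le0 ltW// opprK; split => //.
  have hd : 0 < (d + 1).+1%:R :> R by rewrite ltr0n.
  apply: (@le_trans _ _ ((1 + tau) * (d + 1).+1%:R^-1)).
    rewrite ler_pdivlMr// -natr1; lra.
  by rewrite ler_wpM2l//; lra.
lra.
Qed.

End EnvelopeContact.

(** * First-order expansions of Hoelder functions *)

Section RealLine.
Context {R : realType}.
Implicit Types (a b c t : R).

Lemma powR_small alpha C e : 0 < alpha -> 0 <= C -> 0 < e ->
  exists2 r, 0 < r & forall t, 0 <= t -> t < r -> C * t `^ alpha < e.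
Proof.
move=> a0 C0 e0; have C1 : 0 < C + 1 by lra.
exists ((e / (C + 1)) `^ alpha^-1) => [|t t0 tr].
  by rewrite powR_gt0// divr_gt0.
have : t `^ alpha < e / (C + 1).
  have -> : e / (C + 1) = ((e / (C + 1)) `^ alpha^-1) `^ alpha.
    by rewrite -powRrM mulVf ?gt_eqF// powRr1// divr_ge0// ltW.
  by rewrite gt0_ltr_powR// nnegrE ?powR_ge0.
rewrite ltr_pdivlMr// => h; have := powR_ge0 t alpha; nra.
Qed.

Lemma powRS t alpha : 0 <= t -> 0 < alpha -> t `^ (1 + alpha) = t * t `^ alpha.
Proof.
move=> t0 a0; rewrite powRD ?powRr1//.
by rewrite gt_eqF//; lra.
Qed.

Lemma ler_powR2 s a b : 0 <= s -> 0 <= a -> a <= b -> a `^ s <= b `^ s.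
Proof.
move=> s0 a0 ab; apply: ge0_ler_powR; rewrite ?nnegrE//; exact: le_trans ab.
Qed.

Lemma mean_value_0 (phi phi' : R -> R) b :
  (forall c, `|c| <= `|b| -> is_derive c 1 phi (phi' c)) ->
  exists2 c, `|c| <= `|b| & phi b - phi 0 = phi' c * b.
Proof.
move=> h.
have cont x y : (forall c, x <= c <= y -> `|c| <= `|b|) ->
    {within `[x, y], continuous phi}.
  move=> hxy; apply: derivable_within_continuous => c; rewrite in_itv /= => cxy.
  by have [] := h c (hxy c cxy).
have [b0|b0] := leP 0 b.
  have le c : 0 <= c <= b -> `|c| <= `|b|.
    by move=> /andP[c0 cb]; rewrite !ger0_norm.
  have [|c] := @MVT_segment _ phi phi' 0 b b0 _ (cont _ _ le).
    by move=> c /[!in_itv]/= /andP[c0 cb]; apply: h; apply: le; rewrite !ltW.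
  by rewrite in_itv/= subr0 => /le hc ->; exists c.
have le c : b <= c <= 0 -> `|c| <= `|b|.
  by move=> /andP[cb c0]; rewrite !ler0_norm ?lerN2// ltW.
have [|c] := @MVT_segment _ phi phi' b 0 (ltW b0) _ (cont _ _ le).
  by move=> c /[!in_itv]/= /andP[c0 cb]; apply: h; apply: le; rewrite !ltW.
rewrite in_itv/= sub0r => /le hc E; exists c => //.
by rewrite -[LHS]opprB E mulrN opprK.
Qed.

Lemma is_derive_power (phi : R -> R) t p C r alpha : 0 < alpha -> 0 <= C -> 0 < r ->
  (forall h, `|h| < r -> `|phi (t + h) - phi t - p * h| <= C * `|h| `^ (1 + alpha)) ->
  is_derive t 1 phi p.
Proof.
move=> a0 C0 r0 hphi.
have cv : (fun h => h^-1 *: ((phi \o shift t) (h *: 1) - phi t)) @ 0^' --> p.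
  apply/cvgrPdist_lt => e e0; have [q q0 hq] := powR_small a0 C0 e0.
  rewrite near_withinE; apply/nbhs_ballP; exists (Num.min r q) => /=.
    by rewrite lt_min r0.
  move=> h; rewrite -ball_normE /= sub0r normrN lt_min => /andP[hr hq'] h0.
  rewrite /= [h *: 1]mulr1 (addrC h) distrC.
  have h_gt0 : 0 < `|h| by rewrite normr_gt0.
  have -> : h^-1 *: (phi (t + h) - phi t) - p = h^-1 * (phi (t + h) - phi t - p * h).
    by rewrite mulrBr (mulrC p) mulKf.
  rewrite normrM normfV ltr_pdivrMl//.
  apply: le_lt_trans (hphi h hr) _; rewrite powRS// mulrCA ltr_pM2l//.
  exact: hq.
by split; [exact: (cvgP p) | exact: cvg_lim].
Qed.

(** For small t the term C t^s is negligible against t p. This is how the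
    first-order part of an expansion is seen to vanish at a minimum. *)
Lemma slope_ge0 p C s r : 1 < s -> 0 <= C -> 0 < r ->
  (forall t, 0 < t < r -> 0 <= t * p + C * t `^ s) -> 0 <= p.
Proof.
move=> s1 C0 r0 h; rewrite leNgt; apply/negP => p0.
have [||q q0 hq] := @powR_small (s - 1) C (- p) _ C0; [lra..|].
pose t := Num.min r q / 2.
have m0 : 0 < Num.min r q by rewrite lt_min r0.
have t0 : 0 < t by rewrite /t; lra.
have tm : t < Num.min r q by rewrite /t; lra.
have /andP[tr tq] : (t < r) && (t < q) by rewrite -lt_min.
have ht : 0 < t < r by rewrite t0.
have := h t ht; have := hq t (ltW t0) tq.
have -> : t `^ s = t * t `^ (s - 1).
  by rewrite -powRS ?ltW ?subr_gt0// addrC subrK.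
nra.
Qed.

End RealLine.

Section Taylor.
Context {R : realType} {d : nat}.
Implicit Types (Omega : set 'rV[R]_d) (x y z w : 'rV[R]_d) (g : 'rV[R]_d -> R).

(** The only regularity that the error analysis uses, in one form for both
    values of k. For s <= 1 a slope is not determined by the estimate; it is
    required to be zero, so that slopes at different points trivially agree. *)
Definition taylor_bound Omega g (H s : R) : Prop :=
  forall z, Omega z -> exists2 a, a = 0 \/ 1 < s &
    forall y, closure Omega y ->
      `|g y - g z - dot a (y - z)| <= H * enorm (y - z) `^ s.

Definition gradient g x : 'rV[R]_d := \row_i 'D_(delta_mx 0 i) g x.

(** Transfers estimates from Omega to its closure: the open segment from an
    interior point to a point of the closure stays in Omega. *)
Lemma open_segment_limit Omega g y z : strictly_convex Omega ->
  {within closure Omega, continuous g} -> Omega z -> closure Omega y ->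
  forall e, 0 < e -> exists2 t, 0 <= t < 1 & `|g (z + t *: (y - z)) - g y| < e.
Proof.
move=> sc cg Oz Oy e e0.
have [r r0 hr] := (within_continuousP _ _).1 cg y Oy e e0.
pose N := enorm (y - z) + 1.
have N0 : 0 < N by rewrite ltr_wpDl ?enorm_ge0.
pose t := 1 - Num.min 1 (r / N) / 2.
have m0 : 0 < Num.min 1 (r / N) by rewrite lt_min ltr01 divr_gt0.
have m1 : Num.min 1 (r / N) <= 1 by rewrite ge_min lexx.
have t01 : 0 <= t < 1 by rewrite /t; lra.
exists t => //; apply: hr.
  by apply: subset_closure; exact: strictly_convex_open_segment.
have -> : z + t *: (y - z) - y = (t - 1) *: (y - z).
  by apply/rowP => i; rewrite !mxE; ring.
rewrite enormZ ltr0_norm; last by lra.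
have : Num.min 1 (r / N) * N <= r by rewrite -ler_pdivlMr// ge_min lexx orbT.
rewrite /t /N; have := enorm_ge0 (y - z); nra.
Qed.

Lemma taylor_order0 Omega g G alpha : strictly_convex Omega -> 0 <= G -> 0 < alpha ->
  {within closure Omega, continuous g} ->
  (forall x y, Omega x -> Omega y -> `|g x - g y| <= G * enorm (x - y) `^ alpha) ->
  taylor_bound Omega g G alpha.
Proof.
move=> sc G0 a0 cg hg z Oz; exists 0; first by left.
move=> y Oy; rewrite dot0l subr0; apply/ler_addgt0Pr => e e0.
have [t t01 ht] := open_segment_limit sc cg Oz Oy e0.
have := hg _ _ (strictly_convex_open_segment sc Oz Oy t01) Oz.
rewrite addrAC subrr add0r enormZ => h.
have h2 : G * (`|t| * enorm (y - z)) `^ alpha <= G * enorm (y - z) `^ alpha.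
  rewrite ler_wpM2l// ler_powR2 ?mulr_ge0 ?enorm_ge0//; first exact: ltW.
  by rewrite ler_piMl ?enorm_ge0// ger0_norm; case/andP: t01 => // _ /ltW.
have -> : g y - g z = (g (z + t *: (y - z)) - g z) - (g (z + t *: (y - z)) - g y).
  by ring.
apply: le_trans (ler_normB _ _) _; lra.
Qed.

Section FirstOrder.
Variables (Omega : set 'rV[R]_d) (g : 'rV[R]_d -> R) (G alpha : R).
Hypothesis oO : open Omega.
Hypothesis sc : strictly_convex Omega.
Hypotheses (G0 : 0 <= G) (a0 : 0 < alpha).
Hypothesis cg : {within closure Omega, continuous g}.
Hypothesis dg : forall x i, Omega x -> derivable g x (delta_mx 0 i).
Hypothesis hg : forall x y i, Omega x -> Omega y ->
  `|gradient g x 0 i - gradient g y 0 i| <= G * enorm (x - y) `^ alpha.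

(* the point reached on leg j of the walk along the coordinate axes from 0 to w *)
Let step w (j : 'I_d) (t : R) : 'rV[R]_d :=
  \row_i (if (i < j)%N then w 0 i else if i == j then t else 0).

Let enorm_step w j t : `|t| <= `|w 0 j| -> enorm (step w j t) <= enorm w.
Proof.
move=> ht; rewrite -(@ler_pXn2r _ 2) ?nnegrE ?enorm_ge0// !enorm_sqr.
apply: ler_sum => i _; rewrite !mxE; case: ifP => // _.
case: eqP => [->|_]; last by rewrite mul0r -expr2 sqr_ge0.
by rewrite -!expr2 -(real_normK (num_real t)) -(real_normK (num_real (w 0 j)))
  ler_pXn2r ?nnegrE.
Qed.

Let is_derive_step z w j t : Omega (z + step w j t) ->
  is_derive t 1 (fun t => g (z + step w j t)) (gradient g (z + step w j t) 0 j).
Proof.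
move=> Ozt; have := @dg _ j Ozt; rewrite /derivable /gradient mxE.
have E : (fun h : R => h^-1 *: ((g \o shift (z + step w j t)) (h *: delta_mx 0 j)
              - g (z + step w j t))) =
         (fun h : R => h^-1 *: (((fun t => g (z + step w j t)) \o shift t) (h *: 1)
              - g (z + step w j t))).
  apply/funext => h; rewrite /=; congr (_ *: (g _ - _)).
  apply/rowP => i; rewrite !mxE eqxx [h *: 1]mulr1/=.
  case: ifP => [ij|_]; last by case: eqP => _ /=; ring.
  have -> : (i == j) = false by apply/negbTE; rewrite -val_eqE/= neq_ltn ij.
  by rewrite mulr0 add0r.
by move=> h; split; [rewrite /derivable -E | rewrite /derive -E].
Qed.

(** Near z, walk along the coordinate axes from z to z + w and apply the mean
    value theorem on each leg. *)
Let local_expansion z r w : (forall y, enorm (y - z) < r -> Omega y) ->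
  enorm w < r ->
  `|g (z + w) - g z - dot (gradient g z) w| <= d%:R * G * enorm w `^ (1 + alpha).
Proof.
move=> hr wr; pose p (j : nat) : 'rV[R]_d := \row_i (if (i < j)%N then w 0 i else 0).
have pd : p d = w by apply/rowP => i; rewrite mxE ltn_ord.
have p0 : p 0%N = 0 by apply/rowP => i; rewrite !mxE.
have tele : g (z + w) - g z = \sum_(j < d) (g (z + p j.+1) - g (z + p j)).
  rewrite -(big_mkord xpredT (fun j => g (z + p j.+1) - g (z + p j))).
  by rewrite (telescope_sumr (fun j => g (z + p j)))// pd p0 addr0.
have Oz : Omega z by apply: hr; rewrite subrr enorm0 (le_lt_trans (enorm_ge0 w)).
rewrite tele /dot -sumrB; apply: (le_trans (ler_norm_sum _ _ _)).
have -> : d%:R * G * enorm w `^ (1 + alpha) =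
    \sum_(j < d) G * enorm w `^ (1 + alpha).
  by rewrite sumr_const card_ord -[RHS]mulr_natl mulrA.
apply: ler_sum => j _.
have Ostep t : `|t| <= `|w 0 j| -> Omega (z + step w j t).
  move=> ht; apply: hr; rewrite addrAC subrr add0r.
  exact: le_lt_trans (enorm_step ht) wr.
have [|c hc] := @mean_value_0 _ (fun t => g (z + step w j t))
    (fun t => gradient g (z + step w j t) 0 j) (w 0 j).
  by move=> c hc; apply: is_derive_step; exact: Ostep.
have -> : step w j (w 0 j) = p j.+1.
  apply/rowP => i; rewrite !mxE ltnS.
  have [ij|ji|/val_inj ->] := ltngtP i j; rewrite ?eqxx//.
  by rewrite -val_eqE/= gtn_eqF.
have -> : step w j 0 = p j.
  by apply/rowP => i; rewrite !mxE; case: ifP => //; case: eqP.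
move=> ->; rewrite -mulrBl normrM powRS ?enorm_ge0// mulrCA mulrC.
have := @hg _ _ j (Ostep _ hc) Oz; rewrite addrAC subrr add0r => h.
apply: ler_pM; rewrite ?normr_ge0 ?normr_coord_le//.
apply: (le_trans h); rewrite ler_wpM2l// ler_powR2 ?enorm_ge0//; first exact: ltW.
exact: enorm_step.
Qed.

(** On a segment the local expansion supplies the derivative, and the mean value
    theorem together with the Hoelder bound on the gradient does the rest. *)
Let open_expansion y z : Omega y -> Omega z ->
  `|g y - g z - dot (gradient g z) (y - z)|
    <= d%:R * G * enorm (y - z) `^ (1 + alpha).
Proof.
move=> Oy Oz; set w := y - z.
have Oseg (t : R) : 0 <= t <= 1 -> Omega (z + t *: w).
  move=> /andP[t0 t1]; have [->|tn1] := eqVneq t 1.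
    by rewrite scale1r /w addrC subrK.
  apply: strictly_convex_open_segment => //; first exact: subset_closure.
  by rewrite t0 lt_neqAle tn1.
pose phi t := g (z + t *: w).
have dphi (t : R) : 0 <= t <= 1 -> is_derive t 1 phi (dot (gradient g (z + t *: w)) w).
  move=> t01; have /nbhs_enormP[r r0 hr] : nbhs (z + t *: w) Omega.
    by apply: open_nbhs_nbhs; split => //; exact: Oseg.
  pose N := enorm w + 1; have N0 : 0 < N by rewrite ltr_wpDl ?enorm_ge0.
  apply: (@is_derive_power _ _ _ _ (d%:R * G * enorm w `^ (1 + alpha)) (r / N) alpha) => //.
  - by rewrite !mulr_ge0 ?powR_ge0.
  - by rewrite divr_gt0.
  move=> h hN; have hw : enorm (h *: w) < r.
    rewrite enormZ; move: hN; rewrite ltr_pdivlMr// /N.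
    by have := normr_ge0 h; have := enorm_ge0 w; nra.
  have := local_expansion hr hw; rewrite enormZ powRM ?enorm_ge0// dotZr.
  rewrite /phi scalerDl addrA (mulrC h) => H; apply: (le_trans H).
  by rewrite mulrCA (mulrC (`|h| `^ _)).
have [|||c] := @MVT_segment _ phi (fun t => dot (gradient g (z + t *: w)) w) 0 1.
- exact: ler01.
- by move=> t /[!in_itv]/= /andP[t0 t1]; apply: dphi; rewrite !ltW.
- apply: derivable_within_continuous => t /[!in_itv]/= t01.
  by have [] := dphi t t01.
rewrite in_itv/= => c01; rewrite /phi scale1r scale0r addr0 subr0 mulr1.
have -> : z + w = y by rewrite /w addrC subrK.
move=> ->; rewrite -dotBl; apply: (le_trans (ler_norm_sum _ _ _)).
have -> : d%:R * G * enorm w `^ (1 + alpha) =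
    \sum_(j < d) G * enorm w `^ (1 + alpha).
  by rewrite sumr_const card_ord -[RHS]mulr_natl mulrA.
apply: ler_sum => j _; rewrite normrM powRS ?enorm_ge0// mulrCA mulrC.
apply: ler_pM; rewrite ?normr_ge0 ?normr_coord_le// !mxE.
have := @hg _ _ j (Oseg _ c01) Oz; rewrite addrAC subrr add0r !mxE => h.
apply: (le_trans h); rewrite ler_wpM2l// ler_powR2 ?enorm_ge0//; first exact: ltW.
rewrite enormZ ler_piMl ?enorm_ge0//; case/andP: c01 => c0 c1.
by rewrite ger0_norm.
Qed.

Lemma taylor_order1 : taylor_bound Omega g (d%:R * G) (1 + alpha).
Proof.
move=> z Oz; exists (gradient g z); first by right; rewrite ltrDl.
move=> y Oy; apply/ler_addgt0Pr => e e0; set a := gradient g z.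
pose k x := g x - dot a x.
have ck : {within closure Omega, continuous k}.
  move=> x; apply: cvgB; first exact: cg.
  by apply: continuous_subspaceT; exact: dot_continuous.
have [t t01 ht] := open_segment_limit sc ck Oz Oy e0.
have := open_expansion (strictly_convex_open_segment sc Oz Oy t01) Oz.
rewrite -/a; set q := z + t *: (y - z) => h.
have h2 : enorm (q - z) `^ (1 + alpha) <= enorm (y - z) `^ (1 + alpha).
  rewrite /q addrAC subrr add0r enormZ.
  rewrite ler_powR2 ?mulr_ge0 ?enorm_ge0 ?addr_ge0 ?ler01 ?(ltW a0)//.
  by rewrite ler_piMl ?enorm_ge0// ger0_norm; case/andP: t01 => // _ /ltW.
have {}h2 := ler_wpM2l (mulr_ge0 (ler0n R d) G0) h2.
have -> : g y - g z - dot a (y - z) = (g q - g z - dot a (q - z)) - (k q - k y).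
  by rewrite /k !dotBr; ring.
apply: le_trans (ler_normB _ _) _; lra.
Qed.

End FirstOrder.

Lemma holder_quotient_le Omega g k alpha s x y :
  has_ubound (holder_quotients k alpha Omega g) -> 0 < alpha ->
  size s = k -> Omega x -> Omega y ->
  `|partial s g x - partial s g y| <=
    sup (holder_quotients k alpha Omega g) * enorm (x - y) `^ alpha.
Proof.
move=> ub a0 ss Ox Oy; have [->|xy] := eqVneq x y.
  by rewrite subrr normr0 subrr enorm0 powR0 ?mulr0// gt_eqF.
have n0 : 0 < enorm (x - y) `^ alpha by rewrite powR_gt0// enorm_gt0 subr_eq0.
by rewrite -ler_pdivrMr//; apply: ub_le_sup => //; exists s, x, y.
Qed.

Lemma holder_sup_ge0 Omega g k alpha : 0 <= sup (holder_quotients k alpha Omega g).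
Proof.
have [->|/set0P [q Qq]] := eqVneq (holder_quotients k alpha Omega g) set0.
  by rewrite sup0.
have [ub|nub] := pselect (has_ubound (holder_quotients k alpha Omega g)); last first.
  by rewrite sup_out// => -[_].
apply: le_trans (ub_le_sup ub Qq); case: Qq => [s [x [y [_ _ _ _ ->]]]].
by rewrite divr_ge0 ?powR_ge0.
Qed.

Lemma holder_taylor Omega g k alpha : (0 < d)%N -> open Omega ->
  strictly_convex Omega -> (k <= 1)%N -> 0 < alpha ->
  holder_space k alpha Omega g ->
  taylor_bound Omega g (d%:R * sup (holder_quotients k alpha Omega g))
    (k%:R + alpha).
Proof.
move=> d0 oO sc k1 a0 [[cg ck] ub].
have G0 := holder_sup_ge0 Omega g k alpha.
case: k k1 ck ub G0 => [|[|//]] _ ck ub G0.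
  rewrite add0r => z Oz.
  have [|a ha h] := @taylor_order0 Omega g
      (sup (holder_quotients 0 alpha Omega g)) alpha sc G0 a0 cg _ z Oz.
    by move=> x y Ox Oy; exact: (@holder_quotient_le _ _ _ _ [::]).
  exists a => // y Oy; apply: (le_trans (h y Oy)).
  by rewrite ler_wpM2r ?powR_ge0// ler_peMl// ler1n.
apply: taylor_order1 => //.
- by move=> x i Ox; have [dg _] := ck [::] isT; exact: (dg isT i x Ox).
- move=> x y i Ox Oy; rewrite !mxE.
  exact: (@holder_quotient_le _ _ _ _ [:: i]).
Qed.

End Taylor.

(** * Geometry of simplicial meshes *)

Section Mesh.
Context {R : realType} {d : nat}.
Variable M : mesh R d.
Implicit Types (x y z : 'rV[R]_d) (T : {set 'I_(nb_nodes M)}).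
Local Notation N := (nb_nodes M).
Local Notation Oh := (mesh_domain M).

Definition mesh_cover : set 'rV[R]_d :=
  [set x | exists2 T, T \in elements M & simplex T x].

(** The vertices of an element, extended by a last coordinate 1, form a basis of
    the space of dimension d + 1, so the barycentric coordinates of y are linear
    in (y, 1). *)
Lemma barycentric_coordinates T : T \in elements M ->
  exists (A : 'I_N -> 'rV[R]_d) (B : 'I_N -> R), forall y,
    \sum_(i in T) (dot (A i) y + B i) = 1 /\
    y = \sum_(i in T) (dot (A i) y + B i) *: node M i.
Proof.
move=> MT; have cT := card_element MT.
have [i0 i0T] : exists i, i \in T.
  by apply/set0Pn; rewrite -card_gt0 cT.
pose V : 'M[R]_(#|T|, d + 1) :=
  \matrix_j row_mx (node M (enum_val j)) (1%:M : 'rV_1).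
have rowV (v : 'rV[R]_#|T|) :
    v *m V = \sum_j v 0 j *: row_mx (node M (enum_val j)) (1%:M : 'rV_1).
  by rewrite mulmx_sum_row; apply: eq_bigr => j _; rewrite rowK.
have lV (v : 'rV[R]_#|T|) : lsubmx (v *m V) = \sum_j v 0 j *: node M (enum_val j).
  rewrite rowV linear_sum; apply: eq_bigr => j _.
  by rewrite linearZ/= row_mxKl.
have rV (v : 'rV[R]_#|T|) : rsubmx (v *m V) 0 0 = \sum_j v 0 j.
  rewrite rowV linear_sum summxE; apply: eq_bigr => j _.
  by rewrite linearZ/= row_mxKr !mxE eqxx mulr1.
have fV : row_free V.
  rewrite -kermx_eq0; apply/rowV0P => v /sub_kermxP vV.
  pose c i := v 0 (enum_rank_in i0T i).
  have cE j : c (enum_val j) = v 0 j by rewrite /c enum_valK_in.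
  have c0 : \sum_(i in T) c i = 0.
    rewrite big_enum_val; have := rV v; rewrite vV linear0 mxE => E.
    by rewrite [RHS]E; apply: eq_bigr => j _.
  have cx0 : \sum_(i in T) c i *: node M i = 0.
    rewrite big_enum_val; have := lV v; rewrite vV linear0 => E.
    by rewrite [RHS]E; apply: eq_bigr => j _; rewrite cE.
  apply/rowP => j; rewrite mxE -cE.
  by apply: (element_nondegenerate MT c0 cx0); exact: enum_valP.
have uV : row_full V by apply/eqP; rewrite (eqP fV) cT addn1.
pose W := pinvmx V.
pose A i := \row_k W (lshift 1 k) (enum_rank_in i0T i).
pose B i := W (rshift d 0) (enum_rank_in i0T i).
exists A, B => y; pose q : 'rV[R]_(d + 1) := row_mx y 1%:M.
have qE i : dot (A i) y + B i = (q *m W) 0 (enum_rank_in i0T i).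
  rewrite mxE big_split_ord/= big_ord1 row_mxEr mxE eqxx mul1r; congr (_ + _).
  by apply: eq_bigr => k _; rewrite row_mxEl mxE mulrC.
have qV : q *m W *m V = q by apply: mulmxKpV; exact: submx_full.
split.
  rewrite big_enum_val/=; under eq_bigr do rewrite qE enum_valK_in.
  by rewrite -rV qV row_mxKr mxE eqxx.
rewrite big_enum_val/=; under eq_bigr do rewrite qE enum_valK_in.
by rewrite -lV qV row_mxKl.
Qed.

Lemma barycentric_unique T (c c' : 'I_N -> R) : T \in elements M ->
  \sum_(i in T) c i = \sum_(i in T) c' i ->
  \sum_(i in T) c i *: node M i = \sum_(i in T) c' i *: node M i ->
  forall i, i \in T -> c i = c' i.
Proof.
move=> MT s1 s2 i iT; apply/eqP; rewrite -subr_eq0; apply/eqP.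
apply: (element_nondegenerate MT (c := fun i => c i - c' i)) iT.
  by rewrite sumrB s1 subrr.
by under eq_bigr do rewrite scalerBl; rewrite sumrB s2 subrr.
Qed.

Lemma affine_continuous (a : 'rV[R]_d) (b : R) : continuous (fun y => dot a y + b).
Proof.
move=> y; apply: (@cvgD _ _ _ (nbhs y) _ (dot a) (cst b) _ _ _ (cvg_cst _)).
exact: dot_continuous.
Qed.

Lemma mesh_domain_positive T (c : 'I_N -> R) : T \in elements M ->
  (forall i, i \in T -> 0 < c i) -> \sum_(i in T) c i = 1 ->
  Oh (\sum_(i in T) c i *: node M i).
Proof.
move=> MT c0 c1; set y := \sum_(i in T) _.
have [A [B AB]] := barycentric_coordinates MT.
have cE i : i \in T -> dot (A i) y + B i = c i.
  move=> iT; apply: (@barycentric_unique T (fun i => dot (A i) y + B i)) iT => //.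
    by rewrite c1 (AB y).1.
  by rewrite -(AB y).2.
suff : nbhs y [set z | forall i, i \in T -> 0 < dot (A i) z + B i].
  apply: filterS => z hz; exists T => //.
  exists (fun i => dot (A i) z + B i); split; first by move=> i /hz/ltW.
    by have [] := AB z.
  by have [] := AB z.
apply: (@filter_forall _ _ (fun i z => i \in T -> 0 < dot (A i) z + B i)
  _ (nbhs_filter y)) => i.
have [iT|_] := boolP (i \in T); last exact: filterE.
have : nbhs (dot (A i) y + B i) [set t : R | 0 < t].
  by apply: lt_nbhsr; rewrite cE// c0.
move/(@affine_continuous (A i) (B i) y) => h.
by have {}h : nbhs y [set z | 0 < dot (A i) z + B i] by []; apply: filterS h.
Qed.

Lemma simplex_closed T : T \in elements M -> closed (simplex T).
Proof.
move=> MT y cy; have [A [B AB]] := barycentric_coordinates MT.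
exists (fun i => dot (A i) y + B i); split; [|by have [] := AB y|by have [] := AB y].
move=> i iT; rewrite leNgt; apply/negP => neg.
have : nbhs (dot (A i) y + B i) [set t : R | t < 0] by exact: lt_nbhsl.
move/(@affine_continuous (A i) (B i) y)/cy => [z [[c [c0 c1 zE]] /= zneg]].
suff E : dot (A i) z + B i = c i by move: zneg; rewrite E ltNge c0.
apply: (@barycentric_unique T (fun i => dot (A i) z + B i)) iT => //.
  by rewrite c1 (AB z).1.
by rewrite -zE -(AB z).2.
Qed.

(** Elements are closed and finitely many, so near x only the elements that
    contain x are met. *)
Lemma near_simplices x :
  nbhs x [set z | forall T, T \in elements M -> simplex T z -> simplex T x].
Proof.
apply: (@filter_forall _ _ (fun T z => T \in elements M -> simplex T z -> simplex T x)
  _ (nbhs_filter x)) => T.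
have [MT|_] := boolP (T \in elements M); last exact: filterE.
have [xT|xT] := pselect (simplex T x); first exact: filterE.
have oT : open (~` simplex T) by rewrite openC; exact: simplex_closed.
by have := open_nbhs_nbhs (conj oT xT); apply: filterS => z nz _ /nz.
Qed.

Lemma mesh_cover_closed : closed mesh_cover.
Proof.
move=> x /(_ _ (near_simplices x))[z [[T MT zT] hz]].
by exists T => //; exact: hz.
Qed.

Lemma mesh_domain_open : open Oh.
Proof. exact: open_interior. Qed.

Lemma closure_mesh_domain_cover : closure Oh `<=` mesh_cover.
Proof.
apply: subset_trans (closure_subset _) _; first exact: interior_subset.
by rewrite -(closure_id _).1//; exact: mesh_cover_closed.
Qed.

Lemma interior_closure_mesh_domain : interior (closure Oh) `<=` Oh.
Proof. by move=> x; apply: filterS; exact: closure_mesh_domain_cover. Qed.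

Lemma simplex_node T i : i \in T -> simplex T (node M i).
Proof.
move=> iT; exists (fun j => (j == i)%:R); split => //.
  by rewrite (bigD1 i)//= eqxx big1 ?addr0// => j /andP[_ /negbTE ->].
rewrite (bigD1 i)//= eqxx scale1r big1 ?addr0// => j /andP[_ /negbTE ->].
by rewrite scale0r.
Qed.

Lemma simplex_bounded T y : simplex T y -> enorm y <= \sum_j enorm (node M j).
Proof.
move=> [c [c0 c1 ->]]; apply: (le_trans (enorm_sum _ _)).
rewrite [leRHS](bigID (mem T))/= ler_wpDr ?sumr_ge0// => [j _|].
  exact: enorm_ge0.
apply: ler_sum => i iT; rewrite enormZ ger0_norm ?c0//.
rewrite ler_piMl ?enorm_ge0// -c1 (bigD1 i)//= lerDl sumr_ge0// => j /andP[jT _].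
exact: c0.
Qed.

Lemma simplex_dist_le_diameter T x y : simplex T x -> simplex T y ->
  enorm (x - y) <= diameter (simplex T).
Proof.
move=> Tx Ty; apply: ub_le_sup; last by exists x, y.
exists (2 * \sum_j enorm (node M j)) => _ [x' [y' [Tx' Ty' ->]]].
have := enormD x' (- y'); rewrite enormN.
have := simplex_bounded Tx'; have := simplex_bounded Ty'; lra.
Qed.

Lemma diameter_le_mesh_size T : T \in elements M ->
  diameter (simplex T) <= mesh_size M.
Proof. by move=> MT; apply: (le_bigmax_cond _ (fun T => diameter (simplex T))). Qed.

Lemma mesh_size_ge0 : 0 <= mesh_size M.
Proof. exact: bigmax_ge_id. Qed.

(** Reduces comparison at arbitrary points to the nodes: the weights are the same
    for all finite element functions and charge only nodes at distance at most h. *)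
Lemma mesh_weights y : mesh_cover y -> exists c : 'I_N -> R,
  [/\ forall i, 0 <= c i, \sum_i c i = 1, y = \sum_i c i *: node M i,
      forall i, c i != 0 -> enorm (node M i - y) <= mesh_size M &
      forall w, fe_space M w -> w y = \sum_i c i * w (node M i)].
Proof.
move=> [T MT Ty]; have [c [c0 c1 yE]] := Ty.
pose c' i := if i \in T then c i else 0.
have c'E (V : lmodType R) (F : 'I_N -> V) :
    \sum_i c' i *: F i = \sum_(i in T) c i *: F i.
  by rewrite [RHS]big_mkcond; apply: eq_bigr => i _; rewrite /c'; case: ifP; rewrite ?scale0r.
have c'1 : \sum_i c' i = 1.
  by rewrite -c1 [RHS]big_mkcond.
exists c'; split => //.
- by move=> i; rewrite /c'; case: ifP => // /c0.
- by rewrite c'E.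
- move=> i; rewrite /c'; case: ifP => [iT _|_]; last by rewrite eqxx.
  apply: le_trans (diameter_le_mesh_size MT).
  by apply: simplex_dist_le_diameter => //; exact: simplex_node.
- move=> w [_ /(_ T MT)[l al wl]]; rewrite wl// {1}yE.
  have -> : \sum_(i in T) c i *: node M i = \sum_i c' i *: node M i by rewrite c'E.
  rewrite affine_combination//; apply: eq_bigr => i _.
  rewrite /c'; case: ifP => [iT|]; last by rewrite !mul0r.
  by rewrite wl//; exact: simplex_node.
Qed.

(** Points with positive barycentric coordinates are interior; moving slightly
    towards the barycenter produces such points near every point of T. *)
Lemma simplex_sub_closure T : T \in elements M -> simplex T `<=` closure Oh.
Proof.
move=> MT y [c [c0 c1 yE]]; apply/closure_enormP => e e0.
pose b := \sum_(i in T) (d.+1)%:R^-1 *: node M i.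
have [t [t0 t1 te]] : exists t : R, [/\ 0 < t, t < 1 & t * enorm (b - y) < e].
  pose n := enorm (b - y) + 1; have n0 : 0 < n by rewrite ltr_wpDl ?enorm_ge0.
  have m0 : 0 < Num.min 1 (e / n) by rewrite lt_min ltr01 divr_gt0.
  have m1 : Num.min 1 (e / n) <= 1 by rewrite ge_min lexx.
  have mn : Num.min 1 (e / n) * n <= e by rewrite -ler_pdivlMr// ge_min lexx orbT.
  exists (Num.min 1 (e / n) / 2); split; [lra | lra |].
  by move: mn m0; rewrite {2}/n mulrDr mulr1; move: (Num.min _ _) => m; lra.
have zE : y + t *: (b - y) =
    \sum_(i in T) ((1 - t) * c i + t * (d.+1)%:R^-1) *: node M i.
  transitivity ((1 - t) *: y + t *: b); first by apply/rowP => i; rewrite !mxE; ring.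
  rewrite yE /b !scaler_sumr -big_split; apply: eq_bigr => i _.
  by rewrite [RHS]scalerDl -!scalerA.
exists (y + t *: (b - y)); last by rewrite addrAC subrr add0r enormZ gtr0_norm.
rewrite zE; apply: mesh_domain_positive => // [i iT|].
  rewrite ltr_wpDl ?mulr_ge0 ?c0//; first by rewrite subr_ge0 ltW.
  by rewrite mulr_gt0// invr_gt0.
rewrite big_split/= -!mulr_sumr c1 sumr_const (card_element MT) -[X in t * X]mulr_natl.
by rewrite divff ?pnatr_eq0// !mulr1 subrK.
Qed.

Lemma node_closure i : closure Oh (node M i).
Proof.
have [T MT iT] := node_in_element i.
by apply: (simplex_sub_closure MT); exact: simplex_node.
Qed.

(** By conformity x_i lies in the common face of T and an element with vertex i,
    and barycentric coordinates in that element are unique. *)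
Lemma simplex_node_mem T i : T \in elements M -> simplex T (node M i) -> i \in T.
Proof.
move=> MT Ti; have [T' MT' iT'] := node_in_element i.
have [c [c0 c1 iE]] : hull (node M) (T :&: T') (node M i).
  by rewrite -(mesh_conforming MT MT'); split => //; exact: simplex_node.
apply/negPn/negP => niT.
have big_TT' (V : nmodType) (F : 'I_N -> V) :
    \sum_(j in T :&: T') F j = \sum_(j in T') (if j \in T then F j else 0).
  rewrite big_mkcond [RHS]big_mkcond; apply: eq_bigr => j _.
  by rewrite inE; do 2 case: (_ \in _).
have := @barycentric_unique T' (fun j => if j \in T then c j else 0)
  (fun j => (j == i)%:R) MT' _ _ i iT'.
rewrite (negbTE niT) eqxx => H; suff /eqP : 0 = 1 :> R by rewrite eq_sym oner_eq0.
apply: H.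
  rewrite -big_TT' c1 (bigD1 i)//= eqxx big1 ?addr0// => j /andP[_ /negbTE ->].
  by [].
transitivity (node M i).
  rewrite [RHS]iE big_TT'; apply: eq_bigr => j _.
  by case: ifP; rewrite ?scale0r.
rewrite (bigD1 i)//= eqxx scale1r big1 ?addr0// => j /andP[_ /negbTE ->].
by rewrite scale0r.
Qed.

(** The barycentric coordinate of a vertex is affine. It changes by 1 along a
    segment from the opposite face to the vertex, and by at most 1 along the
    parallel diameter of a ball inscribed in the element, which is therefore not
    longer than the segment. *)
Lemma inscribed_ball_le T i (k : 'I_N -> R) c s : T \in elements M -> i \in T ->
  \sum_(j in T) k j = 1 -> k i = 0 -> 0 <= s ->
  [set x | enorm (x - c) <= s] `<=` simplex T ->
  2 * s <= enorm (\sum_(j in T) k j *: node M j - node M i).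
Proof.
move=> MT iT k1 ki s0 ball; set D := _ - node M i.
have delta1 (V : lmodType R) (F : 'I_N -> V) :
    \sum_(j in T) (j == i)%:R *: F j = F i.
  rewrite (bigD1 i)//= eqxx scale1r big1 ?addr0// => j /andP[_ /negbTE ->].
  by rewrite scale0r.
have sdelta : \sum_(j in T) (j == i)%:R = 1 :> R.
  by rewrite (bigD1 i)//= eqxx big1 ?addr0// => j /andP[_ /negbTE ->].
have D0 : 0 < enorm D.
  rewrite enorm_gt0 subr_eq0; apply/eqP => E.
  have := @barycentric_unique T k (fun j => (j == i)%:R) MT.
  rewrite k1 sdelta delta1 => /(_ erefl E i iT); rewrite ki eqxx => /eqP.
  by rewrite eq_sym oner_eq0.
pose t := s / enorm D; have t0 : 0 <= t by rewrite divr_ge0// ltW.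
have tD : `|t| * enorm D = s by rewrite ger0_norm// divfK// gt_eqF.
have [m [m0 m1 mE]] : simplex T (c + t *: D).
  by apply: ball; rewrite /= addrAC subrr add0r enormZ tD.
have [n [n0 n1 nE]] : simplex T (c - t *: D).
  by apply: ball; rewrite /= addrAC subrr add0r enormN enormZ tD.
have nile1 : n i <= 1.
  rewrite -n1 (bigD1 i)//= lerDl sumr_ge0// => j /andP[jT _]; exact: n0.
have := @barycentric_unique T m
  (fun j => n j + 2 * t * (k j - (j == i)%:R)) MT _ _ i iT.
rewrite ki eqxx sub0r => H; have {H} E : m i = n i + 2 * t * -1.
  apply: H.
    by rewrite big_split/= -mulr_sumr sumrB k1 sdelta subrr mulr0 addr0 m1 n1.
  rewrite -mE; under eq_bigr do rewrite scalerDl -scalerA scalerBl.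
  rewrite big_split/= -scaler_sumr sumrB delta1 -nE -/D.
  by apply/rowP => l; rewrite !mxE; ring.
have := m0 i iT; rewrite E => h.
rewrite -tD ger0_norm//; nra.
Qed.

Lemma inscribed_le T i (k : 'I_N -> R) : T \in elements M -> i \in T ->
  \sum_(j in T) k j = 1 -> k i = 0 ->
  inscribed_diameter (simplex T) <= enorm (\sum_(j in T) k j *: node M j - node M i).
Proof.
move=> MT iT k1 ki.
rewrite /inscribed_diameter; set E := [set r | _].
have [->|/set0P ne] := eqVneq E set0.
  by rewrite sup0 enorm_ge0.
apply: ge_sup ne _ => _ [c [s [s0 ball ->]]].
exact: inscribed_ball_le ball.
Qed.

Lemma inscribed_gt0 T : (0 < d)%N -> T \in elements M ->
  0 < inscribed_diameter (simplex T).
Proof.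
move=> d0 MT; pose b := \sum_(i in T) (d.+1)%:R^-1 *: node M i.
have b1 : \sum_(i in T) (d.+1)%:R^-1 = 1 :> R.
  by rewrite sumr_const (card_element MT) -[LHS]mulr_natl divff// pnatr_eq0.
have [A [B AB]] := barycentric_coordinates MT.
have bE i : i \in T -> dot (A i) b + B i = (d.+1)%:R^-1.
  move=> iT; apply: (@barycentric_unique T (fun i => dot (A i) b + B i)
    (fun=> (d.+1)%:R^-1)) iT => //; first by rewrite b1 (AB b).1.
  by rewrite -(AB b).2.
have [e e0 he] : exists2 e, 0 < e & forall y, enorm (y - b) < e -> simplex T y.
  apply/nbhs_enormP.
  have : nbhs b [set z | forall i, i \in T -> 0 < dot (A i) z + B i].
    apply: (@filter_forall _ _ (fun i z => i \in T -> 0 < dot (A i) z + B i)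
      _ (nbhs_filter b)) => i.
    have [iT|_] := boolP (i \in T); last exact: filterE.
    have : nbhs (dot (A i) b + B i) [set t : R | 0 < t].
      by apply: lt_nbhsr; rewrite bE// invr_gt0.
    move/(@affine_continuous (A i) (B i) b) => h.
    by have {}h : nbhs b [set z | 0 < dot (A i) z + B i] by []; apply: filterS h.
  apply: filterS => z hz; exists (fun i => dot (A i) z + B i).
  by split; [move=> i /hz/ltW|have [] := AB z|have [] := AB z].
have e2 : 0 < 2 * (e / 2) by lra.
apply: lt_le_trans e2 _; apply: ub_le_sup; last first.
  exists b, (e / 2); split => //; first by lra.
  by move=> y /= hy; apply: he; lra.
have [i [j [iT jT ij]]] : exists i j, [/\ i \in T, j \in T & i != j].
  by apply/card_gt1P; rewrite (card_element MT).
exists (enorm (node M j - node M i)) => _ [c [s [s0 ball ->]]].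
have := @inscribed_ball_le T i (fun l => (l == j)%:R) c s MT iT.
rewrite (negbTE ij) (bigD1 j)//= eqxx big1 ?addr0 => [|l /andP[_ /negbTE ->]//].
move=> /(_ erefl erefl s0 ball).
rewrite (bigD1 j)//= eqxx scale1r big1 ?addr0// => l /andP[_ /negbTE ->].
by rewrite scale0r.
Qed.

Lemma mesh_size_le_inscribed sigma T : (0 < d)%N ->
  shape_regular sigma M -> quasi_uniform sigma M -> T \in elements M ->
  0 <= sigma /\ mesh_size M <= sigma ^+ 2 * inscribed_diameter (simplex T).
Proof.
move=> d0 sr qu MT; have i0 := inscribed_gt0 d0 MT.
have /andP[h1 _] := qu T MT; have := sr T MT; rewrite ler_pdivrMr// => h2.
have [i iT] : exists i, i \in T.
  by apply/set0Pn; rewrite -card_gt0 (card_element MT).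
have dm : 0 <= diameter (simplex T).
  have Ti := simplex_node iT.
  by have := simplex_dist_le_diameter Ti Ti; rewrite subrr enorm0.
have s0 : 0 <= sigma.
  by have := le_trans dm h2; rewrite pmulr_lge0.
split => //; apply: (le_trans h1).
by rewrite expr2 -mulrA ler_wpM2l.
Qed.

Lemma mesh_size_gt0 T : (0 < d)%N -> T \in elements M -> 0 < mesh_size M.
Proof.
move=> d0 MT; have [i [j [iT jT ij]]] : exists i j, [/\ i \in T, j \in T & i != j].
  by apply/card_gt1P; rewrite (card_element MT).
apply: lt_le_trans (diameter_le_mesh_size MT).
apply: lt_le_trans (simplex_dist_le_diameter (simplex_node iT) (simplex_node jT)).
rewrite enorm_gt0 subr_eq0; apply: contraNneq ij => /node_inj ->; exact: eqxx.
Qed.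

(** The barycentric coordinates of a point in two elements are supported on the
    common face, so the affine functions prescribed on the elements agree there. *)
Lemma interpolant_exists (v : 'I_N -> R) :
  exists2 w, fe_space M w & forall i, w (node M i) = v i.
Proof.
pose val_at (y : 'rV[R]_d) (r : R) := exists T (c : 'I_N -> R),
  [/\ T \in elements M, (forall i, i \in T -> 0 <= c i) /\ \sum_(i in T) c i = 1,
      y = \sum_(i in T) c i *: node M i & r = \sum_(i in T) c i * v i].
have face T T' c y : T \in elements M -> T' \in elements M ->
    (forall i, i \in T -> 0 <= c i) -> \sum_(i in T) c i = 1 ->
    y = \sum_(i in T) c i *: node M i -> simplex T' y ->
    forall c'', \sum_(i in T :&: T') c'' i = 1 ->
      y = \sum_(i in T :&: T') c'' i *: node M i ->
    \sum_(i in T) c i * v i = \sum_(i in T :&: T') c'' i * v i.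
  move=> MT MT' c0 c1 yE T'y c'' c''1 yE''.
  have big_TT' (V : nmodType) (F : 'I_N -> V) :
      \sum_(j in T :&: T') F j = \sum_(j in T) (if j \in T' then F j else 0).
    rewrite big_mkcond [RHS]big_mkcond; apply: eq_bigr => j _.
    by rewrite inE; do 2 case: (_ \in _).
  rewrite big_TT'; apply: eq_bigr => i iT.
  rewrite (@barycentric_unique T c (fun j => if j \in T' then c'' j else 0) MT _ _ i iT).
  - by case: ifP; rewrite ?mul0r.
  - by rewrite c1 -big_TT'.
  - rewrite -yE yE'' big_TT'; apply: eq_bigr => j _.
    by case: ifP; rewrite ?scale0r.
have val_unique y r r' : val_at y r -> val_at y r' -> r = r'.
  move=> [T [c [MT [c0 c1] yE ->]]] [T' [c' [MT' [c'0 c'1] yE' ->]]].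
  have Ty : simplex T y by exists c.
  have T'y : simplex T' y by exists c'.
  have [c'' [_ c''1 yE'']] : hull (node M) (T :&: T') y.
    by rewrite -(mesh_conforming MT MT').
  rewrite (face T T' c y MT MT' c0 c1 yE T'y c'')//.
  rewrite (face T' T c' y MT' MT c'0 c'1 yE' Ty c'')//.
  - by apply: eq_bigl => j; rewrite !inE andbC.
  - by rewrite -c''1; apply: eq_bigl => j; rewrite !inE andbC.
  - by rewrite yE''; apply: eq_bigl => j; rewrite !inE andbC.
pose w y := xget 0 (val_at y).
have wE y r : val_at y r -> w y = r.
  by move=> h; apply: (val_unique y) => //; exact: (xgetI _ h).
have wT T : T \in elements M ->
    exists2 l, affine_function l & forall x, simplex T x -> w x = l x.
  move=> MT; have [A [B AB]] := barycentric_coordinates MT.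
  exists (fun x => dot (\sum_(i in T) v i *: A i) x + \sum_(i in T) v i * B i).
    by apply/affine_functionP; exists (\sum_(i in T) v i *: A i), (\sum_(i in T) v i * B i).
  move=> x [c [c0 c1 xE]]; apply: wE; exists T, c; split => //.
  rewrite dotC dot_sumr -big_split; apply: eq_bigr => i iT /=.
  rewrite (@barycentric_unique T c (fun j => dot (A j) x + B j) MT _ _ i iT).
  - by rewrite dotZr (dotC x); ring.
  - by rewrite c1 (AB x).1.
  - by rewrite -xE -(AB x).2.
exists w; last first.
  move=> i; apply: wE; have [T MT iT] := node_in_element i.
  exists T, (fun j => (j == i)%:R); split => //.
  - by split => //; rewrite (bigD1 i)//= eqxx big1 ?addr0// => j /andP[_ /negbTE ->].
  - rewrite (bigD1 i)//= eqxx scale1r big1 ?addr0// => j /andP[_ /negbTE ->].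
    by rewrite scale0r.
  - rewrite (bigD1 i)//= eqxx mul1r big1 ?addr0// => j /andP[_ /negbTE ->].
    by rewrite mul0r.
split => //; apply/within_continuousP => x cx e e0.
have : nbhs x [set z | forall T, T \in elements M -> simplex T x -> simplex T z ->
    `|w z - w x| < e].
  apply: (@filter_forall _ _ (fun T z => T \in elements M -> simplex T x ->
    simplex T z -> `|w z - w x| < e) _ (nbhs_filter x)) => T.
  have [MT|_] := boolP (T \in elements M); last exact: filterE.
  have [xT|xT] := pselect (simplex T x); last by apply: filterE => z _ /xT.
  have [l [a [b lE]] wl] := wT T MT.
  have /cvgrPdist_lt/(_ e e0) := @affine_continuous a b x.
  apply: filterS => z hz _ _ Tz; rewrite wl// wl// !lE distrC; exact: hz.
move=> h; have [r r0 hr] := (nbhs_enormP _ _).1 (filterI h (near_simplices x)).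
exists r => // y cy /hr[h1 h2].
by have [T MT Ty] := closure_mesh_domain_cover cy; apply: (h1 T) => //; exact: h2.
Qed.

Lemma lagrange_interpP (g : 'rV[R]_d -> R) :
  fe_space M (lagrange_interp M g) /\
  forall i, lagrange_interp M g (node M i) = g (node M i).
Proof.
apply: (@xgetPex _ (fun=> 0)
  [set w | fe_space M w /\ forall i, w (node M i) = g (node M i)]).
by have [w h1 h2] := interpolant_exists (fun i => g (node M i)); exists w.
Qed.

End Mesh.

(** * Open convex sets and their boundary *)

Section OpenSets.
Context {R : realType} {d : nat}.
Implicit Types (A : set 'rV[R]_d) (x y z p : 'rV[R]_d).

Lemma boundary_openE A p : open A -> boundary A p <-> closure A p /\ ~ A p.
Proof.
move=> oA; split=> [[cp np]|[cp np]]; split => // ip; apply: np.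
  exact: (open_nbhs_nbhs (conj oA ip)).
exact: interior_subset ip.
Qed.

Lemma enorm_scale_small x (e : R) : 0 < e ->
  exists2 eta, 0 < eta & forall t, `|t| < eta -> enorm (t *: x) < e.
Proof.
move=> e0; have n0 : 0 < enorm x + 1 by rewrite ltr_wpDl ?enorm_ge0.
exists (e / (enorm x + 1)) => [|t]; first by rewrite divr_gt0.
rewrite ltr_pdivlMr// enormZ mulrDr mulr1 => h.
by have := normr_ge0 t; lra.
Qed.

(** The first point of the segment outside A is a boundary point. *)
Lemma boundary_on_segment A x y : open A -> A x -> ~ A y ->
  exists2 t, 0 <= t <= 1 & boundary A (x + t *: (y - x)).
Proof.
move=> oA Ax nAy; pose S := [set t : R | 0 <= t <= 1 /\ ~ A (x + t *: (y - x))].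
have S1 : S 1 by split; rewrite ?ler01 ?lexx// scale1r addrC subrK.
have lS : has_lbound S by exists 0; rewrite /S => t /= [/andP[ht _] _].
have iS : has_inf S by split=> //; exists 1.
have t0 : 0 <= inf S by apply: lb_le_inf; [exists 1 | rewrite /S => t /= [/andP[ht _] _]].
have t1 : inf S <= 1 by exact: ge_inf.
have dz s t : x + s *: (y - x) - (x + t *: (y - x)) = (s - t) *: (y - x).
  by apply/rowP => i; rewrite !mxE; ring.
have nAt : ~ A (x + inf S *: (y - x)).
  move=> At; have /nbhs_enormP[e e0 he] := open_nbhs_nbhs (conj oA At).
  have [eta eta0 heta] := enorm_scale_small (y - x) e0.
  have [t St ht] := inf_adherent eta0 iS; have [t01 nA] := St.
  apply: nA; apply: he; rewrite dz; apply: heta.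
  have : inf S <= t by apply: ge_inf.
  rewrite -subr_ge0 => h; rewrite ger0_norm//; lra.
exists (inf S); first by rewrite t0.
apply/boundary_openE => //; split => //; apply/closure_enormP => e e0.
have {}t0 : 0 < inf S.
  rewrite lt_neqAle t0 andbT; apply: contra_notN nAt => /eqP <-.
  by rewrite scale0r addr0.
have [eta eta0 heta] := enorm_scale_small (y - x) e0.
pose s := inf S - Num.min (inf S) eta / 2.
have m0 : 0 < Num.min (inf S) eta by rewrite lt_min t0.
have m1 : Num.min (inf S) eta <= inf S by rewrite ge_min lexx.
have m2 : Num.min (inf S) eta <= eta by rewrite ge_min lexx orbT.
exists (x + s *: (y - x)); last first.
  rewrite dz; apply: heta; rewrite /s addrAC subrr add0r normrN gtr0_norm; lra.
have [//|nAs] := pselect (A (x + s *: (y - x))); exfalso.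
have : inf S <= s.
  apply: ge_inf => //; split => //; apply/andP; split; rewrite /s; lra.
by rewrite /s; lra.
Qed.

Lemma set_distance_le A x p : A p -> set_distance x A <= enorm (x - p).
Proof.
move=> Ap; apply: ge_inf; last by exists p.
by exists 0 => _ [q _ <-]; exact: enorm_ge0.
Qed.

Lemma set_distance_ge A x (r : R) : A !=set0 ->
  (forall p, A p -> r <= enorm (x - p)) -> r <= set_distance x A.
Proof.
move=> [p Ap] h; apply: lb_le_inf; first by exists (enorm (x - p)), p.
by move=> _ [q Aq <-]; exact: h.
Qed.

Lemma ball_sub_open A x y : open A -> A x ->
  enorm (y - x) < set_distance x (boundary A) -> A y.
Proof.
move=> oA Ax h; have [//|nAy] := pselect (A y); exfalso.
have [t /andP[t0 t1] bt] := boundary_on_segment oA Ax nAy.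
have := set_distance_le x bt; rewrite opprD addNKr enormN enormZ ger0_norm//.
have := enorm_ge0 (y - x); nra.
Qed.

Lemma closed_ball_sub_closure A x y : open A -> A x ->
  enorm (y - x) <= set_distance x (boundary A) -> closure A y.
Proof.
move=> oA Ax h; have [yx|yx] := eqVneq (enorm (y - x)) 0.
  by move/eqP: yx; rewrite enorm_eq0 subr_eq0 => /eqP ->; exact: subset_closure.
have yx0 : 0 < enorm (y - x) by rewrite lt_neqAle eq_sym yx enorm_ge0.
apply/closure_enormP => e e0; have [eta eta0 heta] := enorm_scale_small (y - x) e0.
pose t := Num.min 1 eta / 2.
have m0 : 0 < Num.min 1 eta by rewrite lt_min ltr01.
have m1 : Num.min 1 eta <= 1 by rewrite ge_min lexx.
have m2 : Num.min 1 eta <= eta by rewrite ge_min lexx orbT.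
exists (x + (1 - t) *: (y - x)).
  apply: (ball_sub_open oA Ax); apply: lt_le_trans h.
  rewrite addrAC subrr add0r enormZ ger0_norm /t; nra.
have -> : x + (1 - t) *: (y - x) - y = (- t) *: (y - x).
  by apply/rowP => i; rewrite !mxE; ring.
by apply: heta; rewrite normrN gtr0_norm /t; lra.
Qed.

Lemma boundary_nonempty A x : (0 < d)%N -> bounded_set A -> open A -> A x ->
  boundary A !=set0.
Proof.
move=> d0 /bounded_enorm[r r0 hr] oA Ax; pose i0 := Ordinal d0.
pose y : 'rV[R]_d := const_mx (r + 1).
have nAy : ~ A y.
  move=> /hr; have := normr_coord_le y i0; rewrite mxE gtr0_norm; lra.
have [t _ bt] := boundary_on_segment oA Ax nAy.
by exists (x + t *: (y - x)).
Qed.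

Lemma near_boundary A x (e : R) : (0 < d)%N -> bounded_set A -> open A -> A x ->
  0 < e -> exists2 p, boundary A p & enorm (x - p) < set_distance x (boundary A) + e.
Proof.
move=> d0 bA oA Ax e0; have [p bp] := boundary_nonempty d0 bA oA Ax.
have [|_ [q bq <-] hq] := @inf_adherent _ [set enorm (x - y) | y in boundary A] e e0.
  split; first by exists (enorm (x - p)), p.
  by exists 0 => _ [q _ <-]; exact: enorm_ge0.
by exists q.
Qed.

Lemma convex_setE A : convex_set (A : set (convex_lmodType 'rV[R]_d)) ->
  forall x y t, A x -> A y -> 0 <= t <= 1 -> A ((1 - t) *: x + t *: y).
Proof.
move=> cA x y t Ax Ay /andP[t0 t1].
have := cA y x (Itv01 t0 t1); rewrite !inE => /(_ Ay Ax).
by rewrite addrC.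
Qed.

Section Convex.
Variable A : set 'rV[R]_d.
Hypothesis oA : open A.
Hypothesis cA : forall x y t, A x -> A y -> 0 <= t <= 1 ->
  A ((1 - t) *: x + t *: y).

Lemma closure_convex x y t : closure A x -> closure A y -> 0 <= t <= 1 ->
  closure A ((1 - t) *: x + t *: y).
Proof.
move=> /closure_enormP cx /closure_enormP cy /andP[t0 t1].
apply/closure_enormP => e e0.
have [x' Ax' hx] := cx e e0; have [y' Ay' hy] := cy e e0.
exists ((1 - t) *: x' + t *: y'); first by apply: cA; rewrite ?t0.
have -> : (1 - t) *: x' + t *: y' - ((1 - t) *: x + t *: y) =
    (1 - t) *: (x' - x) + t *: (y' - y).
  by apply/rowP => i; rewrite !mxE; ring.
apply: le_lt_trans (enormD _ _) _; rewrite !enormZ (ger0_norm t0) ger0_norm ?subr_ge0//.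
have [h|h] := leP (enorm (x' - x)) (enorm (y' - y)); nra.
Qed.

(** Replace y by a nearby point of A and compensate the change by moving x within
    the open set. *)
Lemma open_convex_mix x y t : A x -> closure A y -> 0 <= t < 1 ->
  A ((1 - t) *: x + t *: y).
Proof.
move=> Ax /closure_enormP cy /andP[t0 t1].
have /nbhs_enormP[e e0 he] := open_nbhs_nbhs (conj oA Ax).
pose k := t / (1 - t); have k0 : 0 <= k by rewrite divr_ge0// subr_ge0 ltW.
have kt : (1 - t) * k = t by rewrite mulrC divfK// subr_eq0 gt_eqF.
have k1 : 0 < k + 1 by lra.
have [y' Ay' hy] := cy (e / (k + 1)) (divr_gt0 e0 k1).
have Ax' : A (x + k *: (y - y')).
  apply: he; rewrite addrAC subrr add0r enormZ ger0_norm// enormB.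
  move: hy; rewrite ltr_pdivlMr//; have := enorm_ge0 (y' - y); nra.
have := cA Ax' Ay'; move/(_ t); rewrite t0 ltW// => /(_ isT).
congr A; rewrite scalerDr scalerA kt.
by apply/rowP => i; rewrite !mxE; ring.
Qed.

(** A point p' slightly outside has a nearest point q in the closure, and q - p'
    is normal to a supporting hyperplane at q. The hyperplane touches near p and
    not at p itself, which suffices and avoids a limit. *)
Lemma supporting_halfspace p (e : R) : bounded_set A -> interior (closure A) `<=` A ->
  boundary A p -> 0 < e ->
  exists q n, [/\ closure A q, enorm (q - p) < e, enorm n = 1 &
    forall y, closure A y -> 0 <= dot n (y - q)].
Proof.
move=> bA iA /(boundary_openE _ oA)[cp nAp] e0.
have [p' np' hp'] : exists2 p', ~ closure A p' & enorm (p' - p) < e / 2.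
  apply/not_exists2P => h; apply: nAp; apply: iA; apply/interior_enormP.
  exists (e / 2); first by lra.
  by move=> y hy; have [/contrapT//|] := h y.
have [|q cq qmin] := nearest_point p' (closure_compact bA).
  by exists p.
have qp0 : 0 < enorm (q - p').
  by rewrite enorm_gt0 subr_eq0; apply/eqP => qp; apply: np'; rewrite -qp.
exists q, ((enorm (q - p'))^-1 *: (q - p')); split => //.
- apply: le_lt_trans (enorm_triangle q p' p) _.
  have := qmin p cp; rewrite (enormB p p'); lra.
- by rewrite enormZ gtr0_norm ?invr_gt0// mulVf// gt_eqF.
move=> y cy; rewrite dotZl mulr_ge0 ?invr_ge0 ?enorm_ge0//.
apply: nearest_obtuse => t /andP[t0 t1].
have -> : q - p' + t *: (y - q) = ((1 - t) *: q + t *: y) - p'.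
  by apply/rowP => i; rewrite !mxE; ring.
by apply: qmin; apply: closure_convex => //; rewrite (ltW t0).
Qed.

End Convex.

End OpenSets.

Section MeshDistance.
Context {R : realType} {d : nat}.
Variable M : mesh R d.
Local Notation Oh := (mesh_domain M).
Hypothesis cOh : forall x y t, Oh x -> Oh y -> 0 <= t <= 1 ->
  Oh ((1 - t) *: x + t *: y).

(** Follow the segment from an interior node x_i to the boundary point p. It
    starts inside some element T at x_i and can leave T only through the face
    opposite to x_i. That face lies in the closure of the convex domain, so it is
    reached not later than p. *)
Lemma node_boundary_distance i p : Oh (node M i) -> boundary Oh p ->
  exists2 T, T \in elements M &
    inscribed_diameter (simplex T) <= enorm (node M i - p).
Proof.
have oO : open Oh := @mesh_domain_open _ _ M.
move=> Oi /(boundary_openE _ oO)[cp nOp].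
have pi : p - node M i != 0 by rewrite subr_eq0; apply: contra_notN nOp => /eqP ->.
have [r r0 hr] := (nbhs_enormP _ _).1 (@near_simplices _ _ M (node M i)).
have [eta eta0 heta] := enorm_scale_small (p - node M i) r0.
pose t := Num.min 1 eta / 2.
have m0 : 0 < Num.min 1 eta by rewrite lt_min ltr01.
have m1 : Num.min 1 eta <= 1 by rewrite ge_min lexx.
have m2 : Num.min 1 eta <= eta by rewrite ge_min lexx orbT.
have t0 : 0 < t by rewrite /t; lra.
have t1 : t <= 1 by rewrite /t; lra.
have te : t < eta by rewrite /t; lra.
pose z := node M i + t *: (p - node M i).
have cz : closure Oh z.
  have -> : z = (1 - t) *: node M i + t *: p.
    by apply/rowP => j; rewrite !mxE; ring.
  by apply: (closure_convex cOh) => //; [exact: subset_closure | rewrite (ltW t0)].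
have [T MT Tz] := closure_mesh_domain_cover cz.
have iT : i \in T.
  apply: (simplex_node_mem MT); apply: (hr z) => //.
  by rewrite /z addrAC subrr add0r; apply: heta; rewrite gtr0_norm.
exists T => //; have [k [k0 k1 zE]] := Tz.
have krest : \sum_(j in T | j != i) k j = 1 - k i.
  by rewrite -k1 [in RHS](bigD1 i)//= addrAC subrr add0r.
have ki1 : k i < 1.
  rewrite lt_neqAle; apply/andP; split; last first.
    by rewrite -subr_ge0 -krest sumr_ge0// => j /andP[jT _]; exact: k0.
  apply: contra_neqN pi => /eqP ki.
  have kz j : j \in T -> j != i -> k j = 0.
    move=> jT ji; have /eqP := krest; rewrite ki subrr psumr_eq0.
      by move=> /allP/(_ j (mem_index_enum _)); rewrite jT ji => /eqP.
    by move=> l /andP[lT _]; exact: k0.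
  have : t *: (p - node M i) = 0.
    apply: (addrI (node M i)); rewrite -/z zE addr0 (bigD1 i)//= ki scale1r.
    by rewrite big1 ?addr0// => j /andP[jT ji]; rewrite kz// scale0r.
  by move/eqP; rewrite scaler_eq0 gt_eqF//= => /eqP.
have ki0 : 0 < 1 - k i by rewrite subr_gt0.
pose k' j := if j == i then 0 else k j / (1 - k i).
have k'1 : \sum_(j in T) k' j = 1.
  rewrite (bigD1 i)//= /k' eqxx add0r.
  under eq_bigr => j /andP[_ /negbTE ->] do rewrite //.
  by rewrite -mulr_suml krest divff// gt_eqF.
pose q := \sum_(j in T) k' j *: node M j.
have qE : (1 - k i) *: (q - node M i) = t *: (p - node M i).
  have : (1 - k i) *: q + k i *: node M i = z.
    rewrite zE [in RHS](bigD1 i)//= addrC; congr (_ + _).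
    rewrite /q (bigD1 i)//= /k' eqxx scale0r add0r scaler_sumr.
    apply: eq_bigr => j /andP[_ /negbTE ->].
    by rewrite scalerA mulrCA divff ?mulr1// gt_eqF.
  move=> E; have -> : t *: (p - node M i) = z - node M i by rewrite /z addrAC subrr add0r.
  by rewrite -E; apply/rowP => j; rewrite !mxE; ring.
have cq : closure Oh q.
  apply: (simplex_sub_closure MT); exists k'; split => // j jT; rewrite /k'.
  by case: ifP => // _; rewrite divr_ge0 ?k0// ltW.
have k'i : k' i = 0 by rewrite /k' eqxx.
apply: le_trans (inscribed_le MT iT k'1 k'i) _; rewrite -/q (enormB (node M i)).
have [tk|kt] := leP t (1 - k i).
  have := congr1 (@enorm R d) qE; rewrite !enormZ !gtr0_norm// => E.
  have := enorm_ge0 (p - node M i); have := enorm_ge0 (q - node M i); nra.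
exfalso; apply: nOp; pose s := (1 - k i) / t.
have s01 : 0 <= s < 1 by rewrite divr_ge0 ?ltW//= ltr_pdivrMr// mul1r.
have := open_convex_mix oO cOh Oi cq s01; congr Oh.
have : p - node M i = s *: (q - node M i).
  by rewrite /s mulrC -scalerA qE scalerA mulVf ?scale1r// gt_eqF.
by move/eqP; rewrite subr_eq => /eqP ->; apply/rowP => j; rewrite !mxE; ring.
Qed.

End MeshDistance.

(** * Barrier profile and weighted sums *)

Section Tools.
Context {R : realType}.

Lemma bigmin_seq_eq0 (I : eqType) (s : seq I) (a : R) (F : I -> R) :
  \big[Num.min/a]_(v <- s) F v = 0 ->
  [/\ 0 <= a, forall v, v \in s -> 0 <= F v &
      a = 0 \/ exists2 v, v \in s & F v = 0].
Proof.
suff H m : \big[Num.min/a]_(v <- s) F v = m ->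
    [/\ m <= a, forall v, v \in s -> m <= F v & a = m \/ exists2 v, v \in s & F v = m].
  exact: H.
elim: s m => [|v s IH] m.
  by rewrite big_nil => ->; split => //; left.
rewrite big_cons => mE; have [h1 h2 h3] := IH _ erefl.
have mF : m <= F v by rewrite -mE ge_min lexx.
have ms : m <= \big[Num.min/a]_(v <- s) F v by rewrite -mE ge_min lexx orbT.
split; first exact: le_trans h1.
  by move=> w; rewrite inE => /predU1P[->//|/h2]; exact: le_trans.
have [le|lt] := leP (F v) (\big[Num.min/a]_(v <- s) F v).
  by right; exists v; rewrite ?mem_head// -mE; apply/esym/min_idPl.
have {}mE : \big[Num.min/a]_(v <- s) F v = m.
  by rewrite -mE; apply/esym/min_idPr; exact: ltW.
rewrite mE in h3; case: h3 => [->|[w ws <-]]; first by left.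
by right; exists w => //; rewrite inE ws orbT.
Qed.

Lemma finite_max (I : finType) (i0 : I) (F : I -> R) :
  exists j, forall i, F i <= F j.
Proof. by have [j _ h] := @arg_maxP _ _ _ i0 xpredT F isT; exists j => i; exact: h. Qed.

(** Profile of the boundary barrier, as a function of the distance to a
    supporting hyperplane: it is 1 beyond the layer of width b, and its second
    differences at points of the layer are strictly negative even when a step
    leaves the layer. *)
Definition ramp (b r : R) : R := 1 - Num.max 0 (1 - r / b) ^+ 2.

Lemma ramp_ge0 b r : 0 < b -> 0 <= r -> 0 <= ramp b r.
Proof.
move=> b0 r0; rewrite /ramp subr_ge0 -[leRHS](expr1n _ 2) ler_pXn2r ?nnegrE ?le_max ?lexx//.
by rewrite ge_max ler01 lerBlDr lerDl divr_ge0// ltW.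
Qed.

Lemma ramp1 b r : 0 < b -> b <= r -> ramp b r = 1.
Proof.
move=> b0 br; rewrite /ramp max_l ?expr0n ?subr0//.
by rewrite subr_le0 ler_pdivlMr// mul1r.
Qed.

Lemma ramp_le b r : 0 < b -> 0 <= r -> ramp b r <= 2 * (r / b).
Proof.
move=> b0 r0; rewrite /ramp; have x0 : 0 <= r / b by rewrite divr_ge0// ltW.
move: (r / b) x0 => x x0.
have [h|h] := leP 0 (1 - x); nra.
Qed.

Lemma ramp_second_difference b r t : 0 < b -> 0 <= t -> r < b ->
  ramp b (r + t) + ramp b (r - t) - 2 * ramp b r <= - (t / b) ^+ 2.
Proof.
move=> b0 t0 rb; rewrite /ramp !mulrDl mulNr.
have x1 : r / b < 1 by rewrite ltr_pdivrMr// mul1r.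
have y0 : 0 <= t / b by rewrite divr_ge0// ltW.
move: (r / b) (t / b) x1 y0 => x y x1 y0.
rewrite (@max_r _ _ 0 (1 - x)); last by lra.
rewrite (@max_r _ _ 0 (1 - (x - y))); last by lra.
have [h|h] := leP 0 (1 - (x + y)); nra.
Qed.

(** The ramp lies below its tangent line at the mean. *)
Lemma ramp_jensen (I : finType) (c : I -> R) (F : I -> R) b : 0 < b ->
  (forall i, 0 <= c i) -> \sum_i c i = 1 ->
  \sum_i c i * ramp b (F i) <= ramp b (\sum_i c i * F i).
Proof.
move=> b0 c0 c1; set r := \sum_i c i * F i; pose q := Num.max 0 (1 - r / b).
have q0 : 0 <= q by rewrite le_max lexx.
have tangent x : ramp b x <= ramp b r + 2 * q * (x - r) / b.
  rewrite /ramp -/q; have -> : 2 * q * (x - r) / b = 2 * q * (x / b - r / b).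
    by rewrite -mulrBl mulrA.
  rewrite /q; move: (x / b) (r / b) => y z.
  have [h1|h1] := leP 0 (1 - y); have [h2|h2] := leP 0 (1 - z).
  - by have := sqr_ge0 (y - z); nra.
  - by have := sqr_ge0 (1 - y); nra.
  - have y1 : 0 <= y - 1 by lra.
    by have := mulr_ge0 h2 y1; have := sqr_ge0 (1 - z); nra.
  - by nra.
apply: (@le_trans _ _ (\sum_i c i * (ramp b r + 2 * q * (F i - r) / b))).
  by apply: ler_sum => i _; rewrite ler_wpM2l.
have -> : \sum_i c i * (ramp b r + 2 * q * (F i - r) / b) =
    \sum_i (c i * ramp b r + (2 * q / b) * (c i * F i - c i * r)).
  by apply: eq_bigr => i _; ring.
rewrite big_split/= -mulr_suml c1 mul1r -mulr_sumr sumrB -mulr_suml c1 mul1r.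
by rewrite -/r subrr mulr0 addr0.
Qed.

End Tools.

Section Weights.
Context {R : realType} {d N : nat}.
Implicit Types (X : 'I_N -> 'rV[R]_d) (c : 'I_N -> R).

Lemma enorm_sqrD (x y : 'rV[R]_d) :
  enorm (x + y) ^+ 2 = enorm x ^+ 2 + enorm y ^+ 2 + 2 * dot y x.
Proof. by rewrite !enorm_sqr !(dotDl, dotDr) (dotC x y); ring. Qed.

Lemma quadratic_weights X c y z : \sum_i c i = 1 -> y = \sum_i c i *: X i ->
  \sum_i c i * enorm (X i - z) ^+ 2 =
  enorm (y - z) ^+ 2 + \sum_i c i * enorm (X i - y) ^+ 2.
Proof.
move=> c1 yE.
have -> : \sum_i c i * enorm (X i - z) ^+ 2 =
    \sum_i (c i * enorm (X i - y) ^+ 2 + c i * enorm (y - z) ^+ 2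
            + 2 * dot (y - z) (c i *: X i - c i *: y)).
  apply: eq_bigr => i _; have -> : X i - z = (X i - y) + (y - z) by rewrite addrA subrK.
  by rewrite -scalerBr dotZr enorm_sqrD; ring.
rewrite !big_split/= -mulr_suml c1 mul1r -mulr_sumr -dot_sumr sumrB -yE.
by rewrite -scaler_suml c1 scale1r subrr dot0r mulr0 addr0 addrC.
Qed.

Lemma weighted_dot X c (a y z : 'rV[R]_d) : \sum_i c i = 1 ->
  y = \sum_i c i *: X i -> \sum_i c i * dot a (X i - z) = dot a (y - z).
Proof.
move=> c1 yE.
have -> : \sum_i c i * dot a (X i - z) = \sum_i (dot a (c i *: X i) - c i * dot a z).
  by apply: eq_bigr => i _; rewrite dotBr dotZr mulrBr.
by rewrite sumrB -dot_sumr -yE -mulr_suml c1 mul1r dotBr.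
Qed.

Lemma weighted_le c (F : 'I_N -> R) (b : R) : (forall i, 0 <= c i) -> \sum_i c i = 1 ->
  (forall i, c i != 0 -> F i <= b) -> \sum_i c i * F i <= b.
Proof.
move=> c0 c1 h; rewrite -[leRHS]mul1r -c1 mulr_suml; apply: ler_sum => i _.
by have [->|ci] := eqVneq (c i) 0; rewrite ?mul0r// ler_wpM2l// h.
Qed.

End Weights.

(** * The two-scale scheme *)

Section Scheme.
Context {R : realType} {d : nat}.
Variables (Omega : set 'rV[R]_d) (f : 'rV[R]_d -> R) (M : mesh R d).
Variables (sigma delta theta : R) (S : seq 'rV[R]_d) (ueps : 'rV[R]_d -> R).
Local Notation u := (convex_envelope Omega f).
Local Notation Oh := (mesh_domain M).
Local Notation h := (mesh_size M).
Local Notation X := (node M).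
Local Notation I := 'I_(nb_nodes M).
Local Notation D := (fun i => set_distance (X i) (boundary Oh)).
Local Notation rad := (local_scale M delta).
Hypothesis d0 : (0 < d)%N.
Hypothesis oO : open Omega.
Hypothesis bO : bounded_set Omega.
Hypothesis scO : strictly_convex Omega.
Hypothesis cf : {within closure Omega, continuous f}.
Hypothesis fits : mesh_fits Omega M.
Hypothesis sr : shape_regular sigma M.
Hypothesis qu : quasi_uniform sigma M.
Hypothesis h_delta : h <= delta.
Hypothesis theta1 : theta <= 1.
Hypothesis netS : direction_net theta S.
Hypothesis sol : discrete_solution Omega M delta S f ueps.

Let OhO : Oh `<=` Omega. Proof. by have [] := fits. Qed.

Let clO : closure Oh `<=` closure Omega. Proof. exact: closure_subset. Qed.

Let cOh x y t : Oh x -> Oh y -> 0 <= t <= 1 -> Oh ((1 - t) *: x + t *: y).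
Proof. by have [_ c _] := fits; exact: convex_setE. Qed.

Let oOh : open Oh. Proof. exact: mesh_domain_open. Qed.

Let bOh : bounded_set Oh.
Proof.
have [r _ hr] := bounded_enorm bO; apply: (@enorm_bounded _ _ _ r) => x Ohx.
exact/hr/OhO.
Qed.

Lemma interior_node i : ~ boundary_node Omega M i -> Oh (X i).
Proof.
move=> nb; have [_ _ fit] := fits; have [//|nO] := pselect (Oh (X i)).
exfalso; apply/nb/fit/boundary_openE => //; split => //; exact: node_closure.
Qed.

Lemma node_closure_domain i : closure Omega (X i).
Proof. exact/clO/node_closure. Qed.
Arguments node_closure_domain : clear implicits.

Lemma ueps_boundary i : boundary_node Omega M i -> ueps (X i) = u (X i).
Proof.
move=> bi; have [_ _ ->//] := sol.
have /(boundary_openE _ oO)[c n] := bi.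
by rewrite (envelope_boundary bO cf scO c n).
Qed.

Lemma delta_gt0 (i : I) : 0 < delta.
Proof.
have [T MT _] := node_in_element i.
exact: lt_le_trans (mesh_size_gt0 d0 MT) h_delta.
Qed.

(** Shape regularity keeps interior nodes at distance of order h from the
    boundary, so that the local scale resolves the mesh. *)
Lemma local_scale_bounds i : ~ boundary_node Omega M i ->
  [/\ 0 < rad i, rad i <= delta, rad i <= D i &
      h <= (1 + sigma ^+ 2) * rad i].
Proof.
move=> nb; have Oi := interior_node nb.
have de0 := delta_gt0 i.
have [T0 MT0 _] := node_in_element i.
have [s0 _] := mesh_size_le_inscribed d0 sr qu MT0.
have h0 := mesh_size_gt0 d0 MT0.
have Dh : h / (1 + sigma ^+ 2) <= D i.
  apply: set_distance_ge; first exact: (boundary_nonempty d0 bOh oOh Oi).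
  move=> p bp; have [T MT hT] := node_boundary_distance cOh Oi bp.
  have [_ hs] := mesh_size_le_inscribed d0 sr qu MT.
  have i0 := inscribed_gt0 d0 MT.
  apply: le_trans hT; rewrite ler_pdivrMr; nra.
have hs : h / (1 + sigma ^+ 2) <= rad i.
  rewrite le_min Dh andbT; apply: le_trans h_delta.
  rewrite ler_pdivrMr; nra.
split.
- by apply: lt_le_trans hs; rewrite divr_gt0//; nra.
- by rewrite ge_min lexx.
- by rewrite ge_min lexx orbT.
- by move: hs; rewrite ler_pdivrMr ?(mulrC (rad i))//; nra.
Qed.

Lemma ueps_interior i : ~ boundary_node Omega M i ->
  [/\ ueps (X i) <= f (X i),
      forall v, v \in S ->
        2 * ueps (X i) <= ueps (X i + rad i *: v) + ueps (X i - rad i *: v) &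
      ueps (X i) = f (X i) \/ exists2 v, v \in S &
        2 * ueps (X i) = ueps (X i + rad i *: v) + ueps (X i - rad i *: v)].
Proof.
move=> nb; have [r0 _ _ _] := local_scale_bounds nb.
have [_ /(_ i nb)/bigmin_seq_eq0[h1 h2 h3] _] := sol.
split; first by rewrite -subr_ge0.
  move=> v /h2; rewrite /second_difference/= pmulr_lge0 ?invr_gt0 ?exprn_gt0//; lra.
case: h3 => [/eqP|[v vS]].
  by rewrite subr_eq0 => /eqP ->; left.
rewrite /second_difference/= => /eqP; rewrite mulf_eq0 invr_eq0.
rewrite (gt_eqF (exprn_gt0 2 r0)) orbF => /eqP E.
by right; exists v => //; lra.
Qed.

Lemma step_closure i v : ~ boundary_node Omega M i -> enorm v = 1 ->
  closure Oh (X i + rad i *: v) /\ closure Oh (X i - rad i *: v).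
Proof.
move=> nb v1; have [r0 _ rD _] := local_scale_bounds nb.
have Oi := interior_node nb.
split; apply: (closed_ball_sub_closure oOh Oi); rewrite addrAC subrr add0r.
  by rewrite enormZ v1 mulr1 gtr0_norm.
by rewrite enormN enormZ v1 mulr1 gtr0_norm.
Qed.

Let node_weights y : closure Oh y -> exists c : I -> R,
  [/\ forall i, 0 <= c i, \sum_i c i = 1, y = \sum_i c i *: X i,
      forall i, c i != 0 -> enorm (X i - y) <= h &
      ueps y = \sum_i c i * ueps (X i)].
Proof.
move=> /closure_mesh_domain_cover/mesh_weights[c [c0 c1 yE ch cw]].
by exists c; split => //; apply: cw; have [] := sol.
Qed.

Let sphereS v : v \in S -> enorm v = 1.
Proof. by move=> vS; have [/(_ v vS)] := netS. Qed.

(** At a point of contact the second difference of p dominates that of the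
    discrete solution, which is nonnegative. The neighbouring points need not be
    nodes: there p bounds the discrete solution only after nodal interpolation,
    whose error is kappa. *)
Lemma touching_from_above (p : 'rV[R]_d -> R) (mu kappa : R) i v :
  ~ boundary_node Omega M i -> v \in S ->
  (forall j, ueps (X j) <= p (X j) + mu) -> ueps (X i) = p (X i) + mu ->
  (forall y (c : I -> R), y = X i + rad i *: v \/ y = X i - rad i *: v ->
    (forall j, 0 <= c j) -> \sum_j c j = 1 -> y = \sum_j c j *: X j ->
    (forall j, c j != 0 -> enorm (X j - y) <= h) ->
    \sum_j c j * p (X j) <= p y + kappa) ->
  2 * p (X i) <= p (X i + rad i *: v) + p (X i - rad i *: v) + 2 * kappa.
Proof.
move=> nb vS above touch interp.
have [cp cm] := step_closure nb (sphereS vS).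
have bound y : y = X i + rad i *: v \/ y = X i - rad i *: v -> closure Oh y ->
    ueps y <= p y + kappa + mu.
  move=> yv /node_weights[c [c0 c1 yE ch ->]].
  apply: (@le_trans _ _ (\sum_j (c j * p (X j) + c j * mu))).
    by apply: ler_sum => j _; rewrite -mulrDr ler_wpM2l.
  by rewrite big_split/= -mulr_suml c1 mul1r lerD2r; exact: interp.
have [_ /(_ v vS) sub _] := ueps_interior nb.
have := bound _ (or_introl erefl) cp; have := bound _ (or_intror erefl) cm.
lra.
Qed.

(** The nodal values of u form a discrete subsolution because interpolation of a
    convex function increases it; adding a small multiple of the squared norm
    makes it strict, so it cannot touch the discrete solution from below. *)
Lemma envelope_le_ueps i : u (X i) <= ueps (X i).
Proof.
have [r0 r00 hr0] := bounded_enorm bO.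
have nodeR j : enorm (X j) ^+ 2 <= (r0 + 1) ^+ 2.
  have /closure_enormP/(_ 1 ltr01)[y Oy hy] := node_closure_domain j.
  have := enorm_triangle (X j) y 0; rewrite !subr0 (enormB (X j)) => ht.
  have := hr0 y Oy; have := enorm_ge0 (X j).
  by move=> a b; rewrite ler_pXn2r ?nnegrE//; lra.
suff H eta : 0 < eta -> u (X i) <= ueps (X i) + eta * (r0 + 1) ^+ 2.
  apply/ler_addgt0Pr => e e0; have q0 : 0 < (r0 + 1) ^+ 2 by rewrite exprn_gt0//; lra.
  by have := H (e / (r0 + 1) ^+ 2) (divr_gt0 e0 q0); rewrite divfK// gt_eqF.
move=> eta0.
have [k hk] := finite_max i (fun j => u (X j) + eta * enorm (X j) ^+ 2 - ueps (X j)).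
suff E : u (X k) <= ueps (X k).
  have := hk i; have := nodeR k; have := sqr_ge0 (enorm (X i)); nra.
have [bk|nb] := pselect (boundary_node Omega M k); first by rewrite ueps_boundary.
have [_ _ [->|[v vS vE]]] := ueps_interior nb.
  exact/envelope_le/node_closure_domain.
exfalso; have [cp cm] := step_closure nb (sphereS vS).
have [rp _ _ _] := local_scale_bounds nb.
set mu := u (X k) + _ - _ in hk.
have below y : closure Oh y -> u y + eta * enorm y ^+ 2 - mu <= ueps y.
  move=> /node_weights[c [c0 c1 yE ch ->]].
  have uc := envelope_convex bO cf c0 c1 node_closure_domain.
  have qc := quadratic_weights 0 c1 yE; rewrite subr0 in qc.
  have qc0 : 0 <= \sum_j c j * enorm (X j - y) ^+ 2.
    by apply: sumr_ge0 => j _; rewrite mulr_ge0 ?sqr_ge0.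
  apply: (@le_trans _ _ (\sum_j (c j * u (X j) + eta * (c j * enorm (X j - 0) ^+ 2) - c j * mu))).
    rewrite sumrB big_split/= -mulr_sumr -mulr_suml c1 mul1r qc -yE in uc *.
    have := mulr_ge0 (ltW eta0) qc0; lra.
  by apply: ler_sum => j _; rewrite subr0; have := hk j; have := c0 j; nra.
have := below _ cp; have := below _ cm.
have mid := envelope_midpoint bO cf (clO cp) (clO cm).
have -> : enorm (X k - rad k *: v) ^+ 2 =
    enorm (X k) ^+ 2 + rad k ^+ 2 - 2 * rad k * dot v (X k).
  rewrite enorm_sqrD enormN enormZ (sphereS vS) mulr1 gtr0_norm// dotNl dotZl; ring.
have -> : enorm (X k + rad k *: v) ^+ 2 =
    enorm (X k) ^+ 2 + rad k ^+ 2 + 2 * rad k * dot v (X k).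
  rewrite enorm_sqrD enormZ (sphereS vS) mulr1 gtr0_norm// dotZl; ring.
have := mulr_gt0 eta0 (exprn_gt0 2 rp); rewrite /mu; lra.
Qed.

(** ** The upper bound *)

Variables (H s : R).
Hypothesis H0 : 0 <= H.
Hypothesis s02 : 0 < s <= 2.
Hypothesis tu : taylor_bound Omega u H s.

(* trades the power s, the same for all alpha, for a quadratic function that can
   be interpolated and differenced *)
Let powRs_scale (r : R) : 0 < delta -> 0 <= r ->
  r `^ s <= delta `^ s + delta `^ s / delta ^+ 2 * r ^+ 2.
Proof.
have /andP[s0 s2] := s02; move=> de0 r0.
have rE : r = delta * (r / delta) by rewrite mulrCA divff ?mulr1// gt_eqF.
have q0 : 0 <= r / delta by rewrite divr_ge0// ltW.
have -> : delta `^ s / delta ^+ 2 * r ^+ 2 = delta `^ s * (r / delta) ^+ 2.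
  by rewrite expr_div_n; ring.
rewrite {1}rE powRM ?(ltW de0)// -{2}[delta `^ s]mulr1 -mulrDr ler_wpM2l ?powR_ge0//.
have [q1|q1] := leP (r / delta) 1.
  apply: (@le_trans _ _ 1); last by rewrite lerDl sqr_ge0.
  by have := ler_powR2 (ltW s0) q0 q1; rewrite powR1.
apply: (@le_trans _ _ ((r / delta) ^+ 2)); last by rewrite lerDr.
by rewrite -powR_mulrn// ler_powR// (ltW q1).
Qed.

Lemma interpolation_error y (c : I -> R) : Omega y ->
  (forall j, 0 <= c j) -> \sum_j c j = 1 -> y = \sum_j c j *: X j ->
  (forall j, c j != 0 -> enorm (X j - y) <= h) ->
  \sum_j c j * u (X j) <= u y + H * h `^ s.
Proof.
have /andP[s0 _] := s02; move=> Oy c0 c1 yE ch.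
have [a _ ha] := tu Oy.
have lin : \sum_j c j * (u y + dot a (X j - y)) = u y.
  under eq_bigr do rewrite mulrDr; rewrite big_split/= -mulr_suml c1 mul1r.
  by rewrite (weighted_dot _ _ c1 yE) subrr dot0r addr0.
rewrite -{1}lin -lerBlDl -sumrB.
under eq_bigr do rewrite -mulrBr.
apply: weighted_le => // j /ch hj.
have := ha _ (node_closure_domain j); rewrite ler_norml => /andP[_ hu].
have : H * enorm (X j - y) `^ s <= H * h `^ s.
  by rewrite ler_wpM2l// ler_powR2 ?enorm_ge0// ltW.
lra.
Qed.

(* Nodes at distance at most K delta from the boundary have distance at most
   (K + 2) delta = B delta / 4 from a supporting hyperplane, where the ramp of
   width B delta is at most 1/2. *)
Let K : R := (d + 1)%:R.
Let B : R := 4 * (K + 2).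

(** Since theta <= 1, the vector v of S closest to the inner normal n of a
    supporting hyperplane near z satisfies n . v >= 1/2, and the ramp of the
    distance to the hyperplane bends by an amount of order (rad / delta)^2 along
    v at every node of the layer. With the factor m + L this outweighs the
    quadratic part of the expansion of u at z, which serves as a majorant of u,
    so that the barrier Q lies above the discrete solution. At z the ramp is at
    most 1/2, and half of the maximal error m disappears. *)
Lemma boundary_layer_bound z (m : R) : ~ boundary_node Omega M z ->
  D z <= K * delta -> 0 < m -> (forall j, ueps (X j) <= u (X j) + m) ->
  ueps (X z) <= u (X z) + H * delta `^ s +
    (m + 8 * B ^+ 2 * (1 + (1 + sigma ^+ 2) ^+ 2) * H * delta `^ s) / 2.
Proof.
move=> nbz Dz m0 hm; have Oz := interior_node nbz.
have de0 := delta_gt0 z.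
have K0 : 0 < K by rewrite ltr0n addn1.
have B0 : 0 < B by rewrite /B; lra.
have [p bp hp] := near_boundary d0 bOh oOh Oz de0.
have [q [n [cq qp n1 half]]] :=
  supporting_halfspace oOh cOh bOh (@interior_closure_mesh_domain _ _ M) bp de0.
pose ell y := dot n (y - q).
have ellz : ell (X z) <= (K + 2) * delta.
  apply: (le_trans (dot_le _ _)); rewrite n1 mul1r.
  have := enorm_triangle (X z) p q; rewrite (enormB p q); lra.
have [v vS vn] : exists2 v, v \in S & enorm (n - v) <= theta by have [_] := netS; apply.
have v1 := sphereS vS.
pose t := dot n v.
have t12 : 2^-1 <= t.
  have := enorm_sqrD n (- v); rewrite enormN n1 v1 dotNl dotC -/t => E.
  have : enorm (n - v) ^+ 2 <= 1.
    by rewrite -[leRHS](expr1n _ 2) ler_pXn2r ?nnegrE ?enorm_ge0//; exact: le_trans theta1.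
  lra.
pose A := H * (delta `^ s / delta ^+ 2).
have A0 : 0 <= A by rewrite mulr_ge0 ?divr_ge0 ?powR_ge0 ?sqr_ge0.
set L := 8 * _ * _ * _ * _.
have LE : L = 8 * B ^+ 2 * delta ^+ 2 * (1 + (1 + sigma ^+ 2) ^+ 2) * A.
  rewrite /L /A; have : delta ^+ 2 != 0 by rewrite gt_eqF// exprn_gt0.
  by move: (delta ^+ 2) (delta `^ s) => x y x0; field.
have L0 : 0 <= L.
  rewrite LE; apply: mulr_ge0 => //; apply: mulr_ge0.
    by do 2 (apply: mulr_ge0; rewrite ?sqr_ge0//).
  by rewrite addr_ge0 ?ler01 ?sqr_ge0.
pose G := m + L; have G0 : 0 < G by rewrite /G; lra.
have b0 : 0 < B * delta by rewrite mulr_gt0.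
have [a _ ha] := tu (OhO Oz).
pose P y := u (X z) + dot a (y - X z) + A * enorm (y - X z) ^+ 2 + H * delta `^ s.
pose Q y := P y + G * ramp (B * delta) (ell y).
have uP y : closure Omega y -> u y <= P y.
  move=> Oy; have := ha y Oy; rewrite ler_norml => /andP[_ hu].
  have := ler_wpM2l H0 (powRs_scale de0 (enorm_ge0 (y - X z))).
  rewrite /P /A; lra.
have ell0 j : 0 <= ell (X j) by apply: half; exact: node_closure.
have QB j : P (X j) <= Q (X j).
  by rewrite lerDl mulr_ge0 ?ramp_ge0// ltW.
suff [k hk Qk] : exists2 k, forall j, ueps (X j) - Q (X j) <= ueps (X k) - Q (X k) &
    ueps (X k) <= Q (X k).
  have := hk z; have := ramp_le b0 (ell0 z) => hr hQ.
  have {}hr : ramp (B * delta) (ell (X z)) <= 2^-1.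
    apply: (le_trans hr); rewrite mulrA ler_pdivrMr// /B; lra.
  have {}hQ : ueps (X z) <= Q (X z) by lra.
  have PXz : P (X z) = u (X z) + H * delta `^ s.
    by rewrite /P subrr dot0r enorm0 expr0n/= mulr0 !addr0.
  apply: (le_trans hQ); rewrite /Q PXz.
  have := ler_wpM2l (ltW G0) hr; rewrite /G; lra.
have [k hk] := finite_max z (fun j => ueps (X j) - Q (X j)); exists k => //.
have [bk|nbk] := pselect (boundary_node Omega M k).
  rewrite (ueps_boundary bk); exact: le_trans (uP _ (node_closure_domain k)) (QB k).
have [far|near] := leP (B * delta) (ell (X k)).
  apply: (le_trans (hm k)); rewrite /Q ramp1// mulr1 /G.
  have := uP _ (node_closure_domain k); lra.
rewrite leNgt; apply/negP => lt.
have [r0 rde _ hr] := local_scale_bounds nbk.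
set x := X k in near lt *; set r := rad k in r0 rde hr *.
have touch : 2 * Q x <= Q (x + r *: v) + Q (x - r *: v) + 2 * (A * h ^+ 2).
  apply: (@touching_from_above Q (ueps x - Q x) (A * h ^+ 2)) => //.
  - by move=> j; have := hk j; rewrite -/x; lra.
  - by rewrite -/x; lra.
  move=> y c _ c0 c1 yE ch.
  have jen := ramp_jensen (fun j => ell (X j)) b0 c0 c1.
  rewrite (weighted_dot _ _ c1 yE) -/(ell y) in jen.
  have quad := quadratic_weights (X z) c1 yE.
  have hq : \sum_j c j * enorm (X j - y) ^+ 2 <= h ^+ 2.
    apply: weighted_le => // j /ch hj.
    by rewrite ler_pXn2r ?nnegrE ?enorm_ge0// mesh_size_ge0.
  have -> : \sum_j c j * Q (X j) = \sum_j (c j * (u (X z) + H * delta `^ s)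
      + c j * dot a (X j - X z) + A * (c j * enorm (X j - X z) ^+ 2)
      + G * (c j * ramp (B * delta) (ell (X j)))).
    by apply: eq_bigr => j _; rewrite /Q /P; ring.
  rewrite !big_split/= -mulr_suml c1 mul1r -!mulr_sumr (weighted_dot _ _ c1 yE) quad.
  rewrite /Q /P; have := ler_wpM2l A0 hq; have := ler_wpM2l (ltW G0) jen; lra.
have rv : enorm (r *: v) ^+ 2 = r ^+ 2.
  by rewrite enormZ v1 mulr1 gtr0_norm.
have Pdiff : P (x + r *: v) + P (x - r *: v) = 2 * P x + 2 * (A * r ^+ 2).
  rewrite /P (addrAC x (r *: v)) (addrAC x (- (r *: v))).
  move: (x - X z) => y; rewrite !enorm_sqrD enormN rv dotNl !(dotDr a y) dotNr.
  ring.
have elldiff : ell (x + r *: v) = ell x + r * t /\ ell (x - r *: v) = ell x - r * t.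
  by rewrite /ell /t !dotBr dotDr dotZr; split; ring.
have t0 : 0 <= t by lra.
have := ramp_second_difference b0 (mulr_ge0 (ltW r0) t0) near.
rewrite -elldiff.1 -elldiff.2 => ramp2.
pose w := (r / (B * delta)) ^+ 2.
have w0 : 0 < w by rewrite exprn_gt0// divr_gt0.
have wt : (r * t / (B * delta)) ^+ 2 = w * t ^+ 2 by rewrite /w; ring.
have t2 : 4^-1 <= t ^+ 2 by nra.
have Lw : L * w = 4 * (2 * A * (r ^+ 2 * (1 + (1 + sigma ^+ 2) ^+ 2))).
  rewrite LE /w; have de1 : delta != 0 by rewrite gt_eqF.
  have B1 : B != 0 by rewrite gt_eqF.
  by move: B B1 => B' B1; field; rewrite de1.
have hh : h ^+ 2 <= (1 + sigma ^+ 2) ^+ 2 * r ^+ 2.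
  rewrite -exprMn ler_pXn2r ?nnegrE ?mesh_size_ge0//.
  by rewrite mulr_ge0 ?(ltW r0)// addr_ge0 ?sqr_ge0.
have e1 := ler_wpM2l A0 hh.
have e2 := ler_wpM2l (ltW G0) ramp2; rewrite wt in e2.
have e3 := ler_wpM2l (mulr_ge0 (ltW G0) (ltW w0)) t2.
have e4 : 0 < m * w by rewrite mulr_gt0.
rewrite /Q in touch; rewrite /G in e2 e3 touch; lra.
Qed.

Variable Hf : R.
Hypothesis Hf0 : 0 <= Hf.
Hypothesis tf : taylor_bound Omega f Hf s.

(** f - u is nonnegative and vanishes at a contact point inside Omega, so that
    its first-order part vanishes there as well. *)
Lemma contact_gap x y : Omega y -> u y = f y -> closure Omega x ->
  f x - u x <= (Hf + H) * enorm (x - y) `^ s.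
Proof.
move=> Oy uf Ox; have [au au0 hu] := tu Oy; have [af af0 hf] := tf Oy.
set w := x - y.
have p0 : 0 <= dot (au - af) w.
  have [s1|s1] := leP s 1.
    have a0 a : a = 0 \/ 1 < s -> a = 0 :> 'rV[R]_d.
      by move=> [//|]; rewrite ltNge s1.
    by rewrite (a0 _ au0) (a0 _ af0) subrr dot0l.
  have /nbhs_enormP[e e0 he] := open_nbhs_nbhs (conj oO Oy).
  have [eta eta0 heta] := enorm_scale_small w e0.
  have HH : 0 <= (Hf + H) * enorm w `^ s by rewrite mulr_ge0 ?addr_ge0 ?powR_ge0.
  apply: (slope_ge0 s1 HH eta0) => t /andP[t0 te].
  have Ot : Omega (y - t *: w).
    by apply: he; rewrite addrAC subrr add0r enormN; apply: heta; rewrite gtr0_norm.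
  have cOt := subset_closure Ot.
  have := envelope_le bO cf cOt; have := hu _ cOt; have := hf _ cOt.
  have -> : y - t *: w - y = - (t *: w) by rewrite addrAC subrr add0r.
  rewrite enormN enormZ (gtr0_norm t0) powRM ?enorm_ge0 ?(ltW t0)//.
  rewrite !dotNr !dotZr !ler_norml dotBl uf => /andP[_ h1] /andP[h2 _] h3; lra.
have := hu _ Ox; have := hf _ Ox; rewrite -/w !ler_norml uf => /andP[_ h1] /andP[h2 _].
by rewrite dotBl in p0; lra.
Qed.

(** By convexity the sum of u at the two ends of a segment centred at x is
    smallest for the position in which u does not bend. Hence the first-order
    terms of turning the segment cancel. *)
Lemma turned_second_difference x w0 w : Omega (x + w0) -> Omega (x - w0) ->
  u (x + w0) + u (x - w0) <= 2 * u x ->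
  closure Omega (x + (w0 + w)) -> closure Omega (x - (w0 + w)) ->
  u (x + (w0 + w)) + u (x - (w0 + w)) <= 2 * u x + 2 * (H * enorm w `^ s).
Proof.
move=> Op Om flat cp cm; have [ap ap0 hp] := tu Op; have [am am0 hm] := tu Om.
have ep (v : 'rV[R]_d) : x + (w0 + v) - (x + w0) = v.
  by apply/rowP => i; rewrite !mxE; ring.
have em (v : 'rV[R]_d) : x - (w0 + v) - (x - w0) = - v.
  by apply/rowP => i; rewrite !mxE; ring.
have p0 : 0 <= dot (am - ap) w.
  have [s1|s1] := leP s 1.
    have a0 a : a = 0 \/ 1 < s -> a = 0 :> 'rV[R]_d.
      by move=> [//|]; rewrite ltNge s1.
    by rewrite (a0 _ ap0) (a0 _ am0) subrr dot0l.
  have /nbhs_enormP[e1 e10 he1] := open_nbhs_nbhs (conj oO Op).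
  have /nbhs_enormP[e2 e20 he2] := open_nbhs_nbhs (conj oO Om).
  have e0 : 0 < Num.min e1 e2 by rewrite lt_min e10.
  have [eta eta0 heta] := enorm_scale_small w e0.
  have HH : 0 <= 2 * H * enorm w `^ s by rewrite !mulr_ge0 ?powR_ge0.
  apply: (slope_ge0 s1 HH eta0) => t /andP[t0 te].
  have : enorm (t *: w) < Num.min e1 e2 by apply: heta; rewrite gtr0_norm.
  rewrite lt_min => /andP[t1 t2].
  have Otp : closure Omega (x + (w0 + - (t *: w))).
    by apply: subset_closure; apply: he1; rewrite ep enormN.
  have Otm : closure Omega (x - (w0 + - (t *: w))).
    by apply: subset_closure; apply: he2; rewrite em opprK.
  have := envelope_midpoint bO cf Otp Otm; have := hp _ Otp; have := hm _ Otm.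
  rewrite ep em opprK enormN enormZ (gtr0_norm t0) powRM ?enorm_ge0 ?(ltW t0)//.
  rewrite dotNr !dotZr !ler_norml dotBl => /andP[_ h1] /andP[_ h2] h3; lra.
have := hp _ cp; have := hm _ cm; rewrite ep em enormN dotNr !ler_norml.
by rewrite dotBl in p0 => /andP[_ h1] /andP[_ h2]; lra.
Qed.

(** If u does not bend at the node in some direction, then u - A |.|^2 is strictly
    concave there in the closest direction of S, because A exceeds the errors of
    turning and of interpolation, and cannot touch the discrete solution from
    above. So a contact point is near, and the obstacle bounds the discrete
    solution. *)
Lemma interior_bound k (A : R) : ~ boundary_node Omega M k -> K * delta < D k ->
  0 <= A -> H * ((delta * theta) `^ s + h `^ s) < A * delta ^+ 2 ->
  (forall j, ueps (X j) - u (X j) + A * enorm (X j) ^+ 2 <=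
             ueps (X k) - u (X k) + A * enorm (X k) ^+ 2) ->
  ueps (X k) - u (X k) <= (Hf + H) * (K * delta) `^ s.
Proof.
have /andP[s0 s2] := s02.
move=> nb Dk A0 HA kmax; set x := X k.
have Ox : Oh x := interior_node nb.
have de0 := delta_gt0 k.
have K1 : 1 <= K by rewrite ler1n addn1.
have radE : rad k = delta.
  by rewrite /local_scale min_l//; apply: le_trans (ltW Dk); rewrite ler_peMl// ltW.
have inOh y : enorm (y - x) <= K * delta -> Oh y.
  by move=> hy; apply: (ball_sub_open oOh Ox); exact: le_lt_trans Dk.
have inOh1 y : enorm (y - x) <= delta -> Oh y.
  by move=> hy; apply: inOh; apply: le_trans hy _; rewrite ler_peMl// ltW.
have cx : closure Omega x := node_closure_domain k.
have [[y [cy uy yx]]|[v v1 flat]] := envelope_dichotomy bO cf cx de0.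
  have Oy : Omega y by apply: OhO; apply: inOh; exact: ltW.
  have [uf _ _] := ueps_interior nb.
  have := contact_gap Oy uy cx; rewrite -/x in uf *.
  have : (Hf + H) * enorm (x - y) `^ s <= (Hf + H) * (K * delta) `^ s.
    rewrite ler_wpM2l ?addr_ge0// ler_powR2 ?enorm_ge0// ?(ltW s0)//.
    by rewrite enormB ltW.
  lra.
exfalso; have [vt vtS vvt] : exists2 w, w \in S & enorm (v - w) <= theta.
  by have [_] := netS; apply.
have vt1 := sphereS vtS.
have dz (z w : 'rV[R]_d) : z + w - z = w by rewrite addrAC subrr add0r.
have dv (w : 'rV[R]_d) : enorm w = 1 -> enorm (delta *: w) = delta.
  by move=> w1; rewrite enormZ w1 mulr1 gtr0_norm.
have turn : delta *: vt = delta *: v + delta *: (vt - v).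
  by apply/rowP => i; rewrite !mxE; ring.
have Op : Oh (x + delta *: vt) by apply: inOh1; rewrite dz dv.
have Om : Oh (x - delta *: vt) by apply: inOh1; rewrite dz enormN dv.
have bend : u (x + delta *: vt) + u (x - delta *: vt) <=
    2 * u x + 2 * (H * (delta * theta) `^ s).
  have := @turned_second_difference x (delta *: v) (delta *: (vt - v)).
  rewrite -turn => /(_ _ _ flat _ _)/le_trans; apply.
  - by apply/OhO/inOh1; rewrite dz dv.
  - by apply/OhO/inOh1; rewrite dz enormN dv.
  - exact/subset_closure/OhO.
  - exact/subset_closure/OhO.
  rewrite lerD2l ler_wpM2l// ler_wpM2l// ler_powR2 ?enorm_ge0 ?(ltW s0)//.
  by rewrite enormZ gtr0_norm// ler_wpM2l ?(ltW de0)// enormB.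
have := @touching_from_above (fun y => u y - A * enorm y ^+ 2)
  (ueps x - u x + A * enorm x ^+ 2) (H * h `^ s) k vt nb vtS.
rewrite radE -/x => touch.
have {touch} : 2 * (u x - A * enorm x ^+ 2) <= u (x + delta *: vt) -
    A * enorm (x + delta *: vt) ^+ 2 + (u (x - delta *: vt) -
    A * enorm (x - delta *: vt) ^+ 2) + 2 * (H * h `^ s).
  apply: touch.
  - by move=> j; have := kmax j; rewrite -/x; lra.
  - by ring.
  move=> y c yE0 c0 c1 yE ch.
  have Oy : Omega y by apply: OhO; case: yE0 => ->.
  have ie := interpolation_error Oy c0 c1 yE ch.
  have quad := quadratic_weights 0 c1 yE; rewrite subr0 in quad.
  have q0 : 0 <= \sum_j c j * enorm (X j - y) ^+ 2.
    by apply: sumr_ge0 => j _; rewrite mulr_ge0 ?sqr_ge0.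
  have -> : \sum_j c j * (u (X j) - A * enorm (X j) ^+ 2) =
      \sum_j (c j * u (X j) - A * (c j * enorm (X j - 0) ^+ 2)).
    by apply: eq_bigr => j _; rewrite subr0; ring.
  rewrite sumrB -mulr_sumr quad; have := mulr_ge0 A0 q0; lra.
rewrite !enorm_sqrD enormN (dv _ vt1) dotNl; lra.
Qed.

(** The maximum of e + A |x|^2 is attained at a boundary node, in the boundary layer
    or away from the boundary; adding A |x|^2 changes the maximum of e by at most
    A r^2. *)
Lemma node_bound (r : R) i : (forall x, closure Omega x -> enorm x <= r) ->
  0 <= theta ->
  ueps (X i) - u (X i) <=
    2 * r ^+ 2 * (H * ((delta * theta) `^ s + h `^ s) / delta ^+ 2)
    + (2 + 8 * B ^+ 2 * (1 + (1 + sigma ^+ 2) ^+ 2) + K ^+ 2) * H * delta `^ s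
    + K ^+ 2 * Hf * delta `^ s.
Proof.
have /andP[s0 s2] := s02; move=> hr th0.
have de0 := delta_gt0 i.
have [i1 i1max] := finite_max i (fun j => ueps (X j) - u (X j)).
apply: le_trans (i1max i) _; set m := ueps (X i1) - u (X i1).
have K1 : 1 <= K by rewrite ler1n addn1.
set L := 8 * _ * _.
have L0 : 0 <= L.
  by rewrite /L !mulr_ge0 ?sqr_ge0// addr_ge0 ?ler01 ?sqr_ge0.
set q := delta `^ s; have q0 : 0 <= q by exact: powR_ge0.
set A0 := H * _ / _.
have A00 : 0 <= A0.
  by rewrite /A0 divr_ge0 ?sqr_ge0// mulr_ge0// addr_ge0 ?powR_ge0.
have Kq : (K * delta) `^ s <= K ^+ 2 * q.
  have K0 : 0 <= K by lra.
  rewrite powRM ?(ltW de0)// ler_wpM2r// -powR_mulrn// ler_powR//.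
have Hq : 0 <= H * q by exact: mulr_ge0.
have Hfq : 0 <= Hf * q by exact: mulr_ge0.
have K2 : 0 <= K ^+ 2 by exact: sqr_ge0.
have HqL : 0 <= L * (H * q) by exact: mulr_ge0.
have HqK : 0 <= K ^+ 2 * (H * q) by exact: mulr_ge0.
have HfqK : 0 <= K ^+ 2 * (Hf * q) by exact: mulr_ge0.
have r2 : 0 <= r ^+ 2 by exact: sqr_ge0.
have rA : 0 <= r ^+ 2 * A0 by exact: mulr_ge0.
have [m0|m0] := leP m 0; first by apply: (le_trans m0); lra.
(* the interior estimate needs A strictly above the consistency error A0 *)
suff main A : A0 < A -> m <= 2 * r ^+ 2 * A + (2 + L + K ^+ 2) * H * q + K ^+ 2 * Hf * q.
  apply/ler_addgt0Pr => e e0.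
  have r21 : 0 < 2 * r ^+ 2 + 1 by lra.
  have := main (A0 + e / (2 * r ^+ 2 + 1)); rewrite ltrDl divr_gt0// => /(_ isT) hm.
  have : 2 * r ^+ 2 * (e / (2 * r ^+ 2 + 1)) <= e.
    by rewrite mulrA ler_pdivrMr// mulrDr mulr1 (mulrC e) lerDl ltW.
  lra.
move=> AA; have A_ge0 : 0 <= A by lra.
have AE : H * ((delta * theta) `^ s + h `^ s) < A * delta ^+ 2.
  by rewrite -ltr_pdivrMr// exprn_gt0.
have nodeR j : enorm (X j) ^+ 2 <= r ^+ 2.
  have hj := hr _ (node_closure_domain j).
  by rewrite ler_pXn2r ?nnegrE ?enorm_ge0//; exact: le_trans (enorm_ge0 _) hj.
have [k kmax] := finite_max i1
  (fun j => ueps (X j) - u (X j) + A * enorm (X j) ^+ 2).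
have mk : m <= ueps (X k) - u (X k) + A * r ^+ 2.
  have := kmax i1; rewrite -/m.
  have := ler_wpM2l A_ge0 (nodeR k); have := mulr_ge0 A_ge0 (sqr_ge0 (enorm (X i1))); lra.
have Ar : 0 <= A * r ^+ 2 by exact: mulr_ge0.
have [bk|nb] := pselect (boundary_node Omega M k).
  by rewrite ueps_boundary// subrr in mk; lra.
have [far|near] := ltP (K * delta) (D k).
  have := interior_bound nb far A_ge0 AE kmax.
  have := ler_wpM2l (addr_ge0 Hf0 H0) Kq; lra.
have := @boundary_layer_bound k m nb near m0.
move=> /(_ _)/le_trans; rewrite -/q => layer.
have : ueps (X k) <= u (X k) + H * q + (m + L * H * q) / 2.
  by apply: layer => // j; have := i1max j; rewrite -/m; lra.
lra.
Qed.

End Scheme.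


Theorem theorem3p7 (R : realType) (d : nat) (Omega : set 'rV[R]_d) (sigma : R) :
  (0 < d)%N -> open Omega -> bounded_set Omega -> strictly_convex Omega ->
  exists2 C : R, 0 < C &
    forall (f : 'rV[R]_d -> R) (k : nat) (alpha : R) (M : mesh R d)
           (delta theta : R) (S : seq 'rV[R]_d) (ueps : 'rV[R]_d -> R),
    let u := convex_envelope Omega f in
    let h := mesh_size M in
    {within closure Omega, continuous f} ->
    (k <= 1)%N -> 0 < alpha <= 1 -> holder_space k alpha Omega u ->
    mesh_fits Omega M -> shape_regular sigma M -> quasi_uniform sigma M ->
    h <= delta -> theta <= 1 -> direction_net theta S ->
    discrete_solution Omega M delta S f ueps ->
    let s := k%:R + alpha in
    (sup_norm (mesh_domain M) (lagrange_interp M u \- ueps)%R <=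
     C%:E *
       (holder_seminorm k alpha Omega u *
          (((delta * theta) `^ s + h `^ s + delta `^ (2 + s))
             / delta ^+ 2)%R%:E +
        holder_seminorm k alpha Omega f * (delta `^ s)%R%:E))%E.
Proof.
move=> d0 oO bO scO; have [r0 r00 hr0] := bounded_enorm bO.
have hr x : closure Omega x -> enorm x <= r0 + 1.
  move=> /closure_enormP/(_ 1 ltr01)[y Oy hy].
  have := enorm_triangle x y 0; rewrite !subr0 (enormB x).
  by have := hr0 y Oy; lra.
pose r := r0 + 1; pose K : R := (d + 1)%:R; pose B := 4 * (K + 2).
pose L := 8 * B ^+ 2 * (1 + (1 + sigma ^+ 2) ^+ 2).
have L0 : 0 <= L.
  by rewrite /L !mulr_ge0 ?sqr_ge0// addr_ge0 ?ler01 ?sqr_ge0.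
have dR : 0 < d%:R :> R by rewrite ltr0n.
have K2 : 0 <= K ^+ 2 := sqr_ge0 K.
have r2 : 0 <= r ^+ 2 := sqr_ge0 r.
exists (d%:R * (2 * r ^+ 2 + 2 + L + K ^+ 2)); first by rewrite mulr_gt0//; lra.
move=> f k alpha M delta theta S ueps u h cf k1 a01 hu fits sr qu hd th1 net sol.
cbv zeta; set s := k%:R + alpha.
have /andP[a0 a1] := a01.
have s02 : 0 < s <= 2.
  rewrite /s; have : (k%:R : R) <= 1 by rewrite -[leRHS]/(1%:R) ler_nat.
  by have := ler0n R k; lra.
apply: ge_ereal_sup => _ [x Ohx <-].
have cx := subset_closure Ohx.
have [T0 MT0 _] := closure_mesh_domain_cover cx.
have de0 : 0 < delta by apply: lt_le_trans hd; exact: mesh_size_gt0 MT0.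
have q0 : 0 < delta `^ s by rewrite powR_gt0.
have th0 : 0 <= theta.
  pose e : 'rV[R]_d := const_mx 1; pose v := (enorm e)^-1 *: e.
  have e0 : 0 < enorm e.
    rewrite enorm_gt0; apply/eqP => /rowP/(_ (Ordinal d0)); rewrite !mxE => /eqP.
    by rewrite oner_eq0.
  have v1 : sphere v by rewrite /sphere/= enormZ gtr0_norm ?invr_gt0// mulVf// gt_eqF.
  by have [_ /(_ v v1)[w _]] := net; apply: le_trans; exact: enorm_ge0.
rewrite {1}/holder_seminorm asboolT//.
set U := sup _; have U0 : 0 <= U by exact: holder_sup_ge0.
rewrite {1}/holder_seminorm; case: asboolP => hf; last first.
  (* without the regularity of f the right-hand side is infinite *)
  rewrite gt0_mulye ?lte_fin// -EFinM addey// gt0_muley ?leey//.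
  by rewrite lte_fin mulr_gt0//; lra.
set F := sup _; have F0 : 0 <= F by exact: holder_sup_ge0.
suff : `|(lagrange_interp M u \- ueps)%R x| <= d%:R * (2 * r ^+ 2 + 2 + L + K ^+ 2) *
    (U * (((delta * theta) `^ s + h `^ s + delta `^ (2 + s)) / delta ^+ 2)
     + F * delta `^ s) by rewrite -lee_fin.
have tu := holder_taylor d0 oO scO k1 a0 hu.
have tf := holder_taylor d0 oO scO k1 a0 hf.
have HU : 0 <= d%:R * U by rewrite mulr_ge0// ltW.
have HF : 0 <= d%:R * F by rewrite mulr_ge0// ltW.
have lower i := envelope_le_ueps d0 oO bO scO cf fits sr qu hd net sol i.
have upper i := node_bound d0 oO bO scO cf fits sr qu hd th1 net sol HU s02 tu HF tf
  i hr th0.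
have [c [c0 c1 _ _ cw]] := mesh_weights (closure_mesh_domain_cover cx).
have [Iu IuE] := lagrange_interpP M u; have [fe _ _] := sol.
rewrite [(_ \- _) x]/= (cw _ Iu) (cw _ fe) -sumrB.
apply: le_trans (ler_norm_sum _ _ _) _.
under eq_bigr do rewrite -mulrBr normrM (ger0_norm (c0 _)).
apply: weighted_le => // i _; rewrite IuE distrC ger0_norm ?subr_ge0//.
apply: le_trans (upper i) _.
rewrite -/s -/h -/r -/K -/B -/L.
have -> : (delta `^ (2 + s)) = delta ^+ 2 * delta `^ s.
  have de_neq0 : (2 + s == 0) ==> (delta != 0) by rewrite (gt_eqF de0) implybT.
  by rewrite (powRD de_neq0) powR_mulrn// ltW.
set E1 := (delta * theta) `^ s + h `^ s.
have E10 : 0 <= E1 / delta ^+ 2.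
  by rewrite divr_ge0 ?sqr_ge0// addr_ge0 ?powR_ge0.
have -> : (E1 + delta ^+ 2 * delta `^ s) / delta ^+ 2 = E1 / delta ^+ 2 + delta `^ s.
  by rewrite mulrDl mulrAC divff ?mul1r// gt_eqF// exprn_gt0.
rewrite -[_ * E1 / _]mulrA; move: (E1 / delta ^+ 2) (delta `^ s) E10 (ltW q0) => E q E0 q1.
have a0' : 0 <= 2 + L + K ^+ 2 by lra.
have b0' : 0 <= 2 * r ^+ 2 by lra.
have c0' : 0 <= 2 * r ^+ 2 + 2 + L by lra.
have := mulr_ge0 a0' (mulr_ge0 HU E0); have := mulr_ge0 b0' (mulr_ge0 HU q1).
have := mulr_ge0 c0' (mulr_ge0 HF q1).
clear; move: L (K ^+ 2) (r ^+ 2) => L' K' r'; lra.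
Qed.
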